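(* Let $q\in\mathbb{C}$, $q\neq 0$, and $M\ge0$. There exists $\varepsilon_0>0$, depending only on $q$ and $M$, such that the following holds. Let $R>0$, $\alpha>0$, $p\in\mathbb{C}$, $\lambda=\frac{p-q}{\alpha}$, let $s:[0,R]\to(0,\infty)$ be smooth with $\dot s(r)>0$ for all $r\in[0,R]$, let $\mathcal{D}=\{(r,z)\in\mathbb{R}^2:\ 0\le z\le s(r),\ 0\le r\le R\}$, and let $\beta:\mathcal{D}\to\mathbb{C}$ be smooth with $\max_{\mathcal D}|\beta|\le M$. Assume that either (i) $\mathrm{Im}\big(q^{-1}+\beta(r,z)\big)$ is of one sign in $\mathcal D$ (i.e. it is $>0$ at every point of $\mathcal D$, or it is $<0$ at every point of $\mathcal D$), or (ii) $\tfrac{1}{\alpha}\max_{0\le r\le R}s(r)\le\varepsilon_0$. Then the initial-boundary-value problem $$(1+q\beta)\,v_r+\alpha^2 q\,v_{zzr}=\mathrm{i}\,\lambda\,(\alpha^2 v_{zz}+\beta v)\quad\text{in }\mathcal D,$$ $$v(0,z)=v_0(z)\ \ (0\le z\le s(0)),\qquad v(r,0)=0,\quad v(r,s(r))=0,\quad v_r(r,s(r))=0\ \ (0\le r\le R),$$ is $L^2$-, $H^1$- and $H^2$-stable: for each $\ell\in\{0,1,2\}$ there is a constant $C$ (independent of $v$, $v_0$ and $r$) such that every sufficiently smooth solution $v:\mathcal D\to\mathbb C$ satisfies $$\|v(r,\cdot)\|_\ell\le C\,\|v_0\|_\ell,\qquad 0\le r\le R .$$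
   Context: Subscripts on $v$ denote partial derivatives ($v_r(r,s(r))$ is the partial derivative in $r$ evaluated at the point $(r,s(r))$), and $\dot s=ds/dr$. The functions $v$, $\beta$, $s$, $v_0$ are assumed sufficiently smooth (one may take $C^\infty$ up to the boundary). The norms are range-dependent norms on $[0,s(r)]$: $\|v(r,\cdot)\|_0=\|v(r,\cdot)\|=\big(\int_0^{s(r)}|v(r,z)|^2dz\big)^{1/2}$, $\|v\|_1=(\|v\|^2+\|v_z\|^2)^{1/2}$, $\|v\|_2=(\|v\|_1^2+\|v_{zz}\|^2)^{1/2}$; $\|v_0\|_\ell$ is the corresponding norm on $[0,s(0)]$. *)

(* Defs.v *)
From Stdlib Require Import Reals.
From Coquelicot Require Import Coquelicot.

Local Open Scope R_scope.

(* "C^oo up to the boundary" on a set [K] means: all partial derivatives exist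
   in the interior of [K] and extend continuously to [K].  A jet is the family
   of these (extended) derivatives; when [K] is the closure of its interior,
   the jet of a function is unique on [K].  Values of functions outside [K]
   are irrelevant. *)

Record smooth_jet1 (K : R -> Prop) (f : R -> R) (F : nat -> R -> R) : Prop := {
  jet1_0 : forall x, K x -> F 0%nat x = f x;
  jet1_cont : forall i, continuous_on K (F i);
  jet1_deriv : forall i x, locally x K -> is_derive (F i) x (F (S i) x)
}.

(* [F i j] stands for the derivative of order [i] in the first variable [r]
   and of order [j] in the second variable [z]. *)
Record smooth_jet2 (K : R -> R -> Prop) (f : R -> R -> C)
    (F : nat -> nat -> R -> R -> C) : Prop := {
  jet2_0 : forall r z, K r z -> F 0%nat 0%nat r z = f r z;
  jet2_cont : forall i j,
    continuous_on (T := prod_UniformSpace R_UniformSpace R_UniformSpace)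
      (U := C_UniformSpace)
      (fun x => K (fst x) (snd x)) (fun x => F i j (fst x) (snd x));
  jet2_dr : forall i j r z, locally_2d K r z ->
    is_derive (K := R_AbsRing) (V := C_R_NormedModule)
      (fun t => F i j t z) r (F (S i) j r z);
  jet2_dz : forall i j r z, locally_2d K r z ->
    is_derive (K := R_AbsRing) (V := C_R_NormedModule)
      (fun t => F i j r t) z (F i (S j) r z)
}.

Definition smooth2 (K : R -> R -> Prop) (f : R -> R -> C) : Prop :=
  exists F, smooth_jet2 K f F.

Definition smooth_increasing (rmax : R) (s : R -> R) : Prop :=
  exists S : nat -> R -> R,
    smooth_jet1 (fun r => 0 <= r <= rmax) s S /\
    (forall r, 0 <= r <= rmax -> 0 < S 1%nat r).

Definition dom (rmax : R) (s : R -> R) (r z : R) : Prop :=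
  0 <= z <= s r /\ 0 <= r <= rmax.

Definition CDerive_n (f : R -> C) (n : nat) (z : R) : C :=
  (Derive_n (fun t => Re (f t)) n z, Derive_n (fun t => Im (f t)) n z).

Definition l2norm (a : R) (f : R -> C) : R :=
  sqrt (RInt (fun z => Cmod (f z) ^ 2) 0 a).

(* The norm of order [l] on [0, a].  The two-sided derivatives may be junk at
   the endpoints 0 and a, which does not affect the integrals. *)
Fixpoint hnorm (a : R) (l : nat) (f : R -> C) : R :=
  match l with
  | O => l2norm a f
  | S k => sqrt (hnorm a k f ^ 2 + l2norm a (CDerive_n f (S k)) ^ 2)
  end.

Local Open Scope C_scope.

(* [v] is a solution, smooth up to the boundary, with initial value [v0].
   Boundary values of derivatives are those of the jet [V]. *)
Definition is_solution (rmax alpha : R) (q lambda : C) (s : R -> R)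
    (beta : R -> R -> C) (v0 : R -> C) (v : R -> R -> C) : Prop :=
  exists V : nat -> nat -> R -> R -> C,
    smooth_jet2 (dom rmax s) v V /\
    (forall r z, dom rmax s r z ->
       (1 + q * beta r z) * V 1%nat 0%nat r z
         + RtoC (alpha ^ 2)%R * q * V 1%nat 2%nat r z
       = Ci * lambda * (RtoC (alpha ^ 2)%R * V 0%nat 2%nat r z
                        + beta r z * v r z)) /\
    (forall z, (0 <= z <= s 0)%R -> v 0%R z = v0 z) /\
    (forall r, (0 <= r <= rmax)%R ->
       v r 0%R = 0 /\ v r (s r) = 0 /\ V 1%nat 0%nat r (s r) = 0).

(* Main.v *)
Require Import Defs.
From Stdlib Require Import Reals.
From Coquelicot Require Import Coquelicot.
From Stdlib Require Import Lra Lia Classical ClassicalEpsilon.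

(* Put [gamma = 1/q + beta], [mu = i lambda / q] and [w = v_r - mu v].  Dividing
   the equation by [q] turns it into the Dirichlet problem
   [gamma w + alpha^2 w_zz = - (mu/q) v] on each slice [0, s(r)].  Testing with
   the conjugate of [w] and taking imaginary parts (one-signed [Im gamma]) or
   real parts with Poincare's inequality (small [s/alpha]) bounds [w], [w_z],
   [w_zz] and the trace [w_z(s)] by [v] in L^2.  Hence
   [v_r = mu v + w] controls the derivative of [||d_z^j v||^2] up to the
   boundary term [s' |d_z^j v|^2] at [z = s(r)].  This term vanishes for
   [j = 0, 1], since [v = v_r = 0] there forces [v_z = 0]; for [j = 2],
   differentiating [v_z = 0] along the boundary gives [v_zz = - v_rz / s'], and
   [v_rz(s) = w_z(s)] is already under control.  Gronwall concludes. *)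

Local Open Scope R_scope.

(** * Real analysis *)

(** Two obstacles shape the proof. The interval [0, s(r)] moves, and a jet satisfies its derivative
    relations only in the interior of the domain, whereas the argument needs traces at z = 0 and z =
    s(r) and the initial slice r = 0. Each jet entry is therefore written in (r, y) with z = s(r) y
    and extended continuously to the whole plane by clamping; derivative identities come from the
    chain rule in the open set and pass to its boundary by continuity. The value of [mu] is the one
    that removes v_zz from the right-hand side, so that the datum of the Dirichlet problem is a
    multiple of v and costs no derivative. The Dirichlet conditions hold for w because v_r vanishes
    at both ends: at z = 0 by differentiating v(r, 0) = 0, at z = s(r) by assumption. Since s' > 0,
    the boundary term of the transport formula has the unfavourable sign. For j = 2 it equals
    |w_z|^2 / s', which is why a positive lower bound of s' enters the constant. Complex functions
    are handled as pairs of real ones. *)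

Definition cont1 (f : R -> R) : Prop := forall x, continuous f x.

Definition cont2 (f : R -> R -> R) : Prop :=
  forall x y, continuity_2d_pt f x y.

Lemma cont2_comp (f g h : R -> R -> R) :
  cont2 f -> cont2 g -> cont2 h -> cont2 (fun x y => f (g x y) (h x y)).
Proof.
  intros Hf Hg Hh x y eps.
  destruct (Hf (g x y) (h x y) eps) as [d Hd].
  apply locally_2d_impl with (2 := locally_2d_and _ _ _ _ (Hg x y d) (Hh x y d)).
  apply locally_2d_forall. intros u v [H1 H2]. now apply Hd.
Qed.

Lemma cont2_plus (f g : R -> R -> R) :
  cont2 f -> cont2 g -> cont2 (fun x y => f x y + g x y).
Proof. intros Hf Hg x y. now apply continuity_2d_pt_plus. Qed.

Lemma cont2_minus (f g : R -> R -> R) :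
  cont2 f -> cont2 g -> cont2 (fun x y => f x y - g x y).
Proof. intros Hf Hg x y. now apply continuity_2d_pt_minus. Qed.

Lemma cont2_mult (f g : R -> R -> R) :
  cont2 f -> cont2 g -> cont2 (fun x y => f x y * g x y).
Proof. intros Hf Hg x y. now apply continuity_2d_pt_mult. Qed.

Lemma cont2_const (c : R) : cont2 (fun _ _ => c).
Proof. intros x y. apply continuity_2d_pt_const. Qed.

Lemma cont2_fst (f : R -> R) :
  cont1 f -> cont2 (fun x _ => f x).
Proof.
  intros Hf x y. apply continuity_1d_2d_pt_comp.
  - apply continuity_pt_filterlim, Hf.
  - apply continuity_2d_pt_id1.
Qed.

Lemma cont2_snd (f : R -> R) :
  cont1 f -> cont2 (fun _ x => f x).
Proof.
  intros Hf x y. apply continuity_1d_2d_pt_comp.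
  - apply continuity_pt_filterlim, Hf.
  - apply continuity_2d_pt_id2.
Qed.

Lemma cont2_swap (f : R -> R -> R) : cont2 f -> cont2 (fun x y => f y x).
Proof.
  intros Hf. apply cont2_comp; trivial.
  - apply (cont2_snd (fun x => x)). intros x. apply continuous_id.
  - apply (cont2_fst (fun x => x)). intros x. apply continuous_id.
Qed.

Lemma cont2_l (f : R -> R -> R) (y x : R) :
  cont2 f -> continuous (fun t => f t y) x.
Proof.
  intros Hf. apply continuity_pt_filterlim. apply continuity_pt_locally.
  intros eps. apply (locally_2d_1d_const_y _ _ _ (Hf x y eps)).
Qed.

Lemma cont2_r (f : R -> R -> R) (x y : R) :
  cont2 f -> continuous (fun t => f x t) y.
Proof. intros Hf. apply (cont2_l (fun t x => f x t)). now apply cont2_swap. Qed.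

Lemma continuous_zero_closed (h : R -> R) (c d : R) :
  c < d -> (forall y, continuous h y) -> (forall y, c < y < d -> h y = 0) ->
  forall y, c <= y <= d -> h y = 0.
Proof.
  intros Hcd Hh H0 y Hy.
  destruct (Req_dec (h y) 0) as [E|E]; trivial. exfalso.
  assert (Hy' := proj2 (continuity_pt_filterlim h y) (Hh y)).
  rewrite continuity_pt_locally in Hy'.
  destruct (Hy' (mkposreal _ (Rabs_pos_lt _ E))) as [e He]; simpl in He.
  assert (He0 := cond_pos e).
  (* Moving [y] by a small fraction [t] towards the midpoint [m] lands in the open interval and
     stays within distance [e] of [y]. *)
  set (m := (c + d) / 2). set (t := Rmin (1 / 2) (e / (2 * (d - c)))).
  assert (Ht : 0 < t) by (unfold t; apply Rmin_glb_lt; [lra | apply Rdiv_lt_0_compat; lra]).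
  assert (Ht1 : t <= 1 / 2) by apply Rmin_l.
  assert (Ht2 : t * (2 * (d - c)) <= e).
  { apply Rle_trans with (e / (2 * (d - c)) * (2 * (d - c))).
    - apply Rmult_le_compat_r; [lra | apply Rmin_r].
    - apply Req_le. field. lra. }
  assert (Hm : Rabs (m - y) <= d - c) by (unfold m; apply Rabs_le; lra).
  assert (Hz : h (y + t * (m - y)) = 0).
  { apply H0. unfold m in *. nra. }
  specialize (He (y + t * (m - y))). rewrite Hz in He.
  replace (0 - h y) with (- h y) in He by ring. rewrite Rabs_Ropp in He.
  apply (Rlt_irrefl (Rabs (h y))), He.
  change (Rabs (y + t * (m - y) - y) < e).
  replace (y + t * (m - y) - y) with (t * (m - y)) by ring.
  rewrite Rabs_mult, (Rabs_pos_eq t) by lra. nra.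
Qed.

(** By the mean value theorem, [f] minus the integral of [g] is constant: its derivative is 0 inside
    and it is continuous up to the ends. The derivative is asked for only in the open interval
    because that is all a jet provides. *)
Lemma RInt_open_derive (f g : R -> R) (a b : R) :
  (forall x, continuous f x) -> (forall x, continuous g x) ->
  (forall x, Rmin a b < x < Rmax a b -> is_derive f x (g x)) ->
  f b - f a = RInt g a b.
Proof.
  intros Hf Hg Hd.
  assert (HI : forall x, is_derive (fun t => RInt g a t) x (g x)).
  { intros x. apply is_derive_RInt with a; [|apply Hg].
    exists (mkposreal 1 Rlt_0_1). intros y _. apply (RInt_correct (V := R_CompleteNormedModule)).
    apply (ex_RInt_continuous (V := R_CompleteNormedModule)). intros; apply Hg. }
  destruct (MVT_gen (fun x => f x - RInt g a x) a b (fun _ => 0)) as [c [_ Hc]].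
  - intros x Hx. replace 0 with (g x - g x) by ring.
    apply (is_derive_minus f (fun t => RInt g a t)); [now apply Hd | apply HI].
  - intros x _. apply continuity_pt_filterlim.
    apply (continuous_minus f (fun t => RInt g a t)); [apply Hf |].
    apply (ex_derive_continuous (fun t => RInt g a t)). eexists; apply HI.
  - rewrite RInt_point in Hc. unfold zero in Hc; simpl in Hc. lra.
Qed.

Lemma ex_RInt_cont (f : R -> R) (a b : R) :
  (forall x, continuous f x) -> ex_RInt f a b.
Proof.
  intros H. apply (ex_RInt_continuous (V := R_CompleteNormedModule)). intros; apply H.
Qed.

Lemma continuous_RInt_param (f : R -> R -> R) (a b y : R) :
  cont2 f -> continuous (fun y => RInt (fun x => f x y) a b) y.
Proof.
  intros Hf.
  assert (W : forall a b, a <= b -> continuous (fun y => RInt (fun x => f x y) a b) y).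
  { clear a b. intros a b Hab. apply continuity_pt_filterlim, continuity_pt_locally.
    intros eps.
    (* The summand 1 keeps the quotient meaningful when a = b. *)
    assert (He : 0 < eps / (b - a + 1)) by (apply Rdiv_lt_0_compat; [apply cond_pos | lra]).
    destruct (uniform_continuity_2d_1d f a b y (fun x _ => Hf x y) (mkposreal _ He)) as [d Hd].
    exists d. intros u Hu. change (Rabs (u - y) < d) in Hu. simpl in Hd.
    assert (Hu' := Rabs_def2 _ _ Hu). assert (Hd0 := cond_pos d).
    assert (Hex : forall v, ex_RInt (fun x => f x v) a b).
    { intros v. apply ex_RInt_cont. intros x. now apply cont2_l. }
    rewrite <- (RInt_minus (V := R_CompleteNormedModule) (fun x => f x u) (fun x => f x y)) by apply Hex.
    apply Rle_lt_trans with ((b - a) * (eps / (b - a + 1))).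
    - apply abs_RInt_le_const; trivial.
      + apply (ex_RInt_minus (V := R_NormedModule)); apply Hex.
      + intros x Hx. apply Rlt_le, Hd; try lra. replace (x - x) with 0 by ring. now rewrite Rabs_R0.
    - apply Rmult_lt_reg_r with (b - a + 1); [lra|].
      replace ((b - a) * (eps / (b - a + 1)) * (b - a + 1)) with ((b - a) * eps) by (field; lra).
      assert (E0 := cond_pos eps). nra. }
  destruct (Rle_dec a b) as [H|H]; [now apply W|].
  apply continuous_ext with (fun y => opp (RInt (fun x => f x y) b a)).
  - intros z. apply (opp_RInt_swap (V := R_CompleteNormedModule)).
    apply ex_RInt_cont. intros x. now apply cont2_l.
  - apply (continuous_opp (fun y => RInt (fun x => f x y) b a)). apply W. lra.
Qed.

(* Both sides of [P x2 y - P x1 y = RInt (Q . y) x1 x2] are continuous in [y],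
   so the identity passes to the end points of [(c, d)]. *)
Lemma is_derive_closed (P Q : R -> R -> R) (a b c d : R) :
  c < d -> cont2 P -> cont2 Q ->
  (forall x y, a < x < b -> c < y < d -> is_derive (fun t => P t y) x (Q x y)) ->
  forall x y, a < x < b -> c <= y <= d -> is_derive (fun t => P t y) x (Q x y).
Proof.
  intros Hcd HP HQ Hd x y Hx Hy.
  assert (HI : forall u, a < u < b -> P u y = P x y + RInt (fun t => Q t y) x u).
  { intros u Hu.
    cut (P u y - P x y - RInt (fun t => Q t y) x u = 0); [lra|].
    apply (continuous_zero_closed (fun y => P u y - P x y - RInt (fun t => Q t y) x u) c d); trivial.
    - intros z. apply (continuous_minus (fun y => P u y - P x y)).
      + apply (continuous_minus (fun y => P u y)); now apply cont2_r.
      + now apply continuous_RInt_param.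
    - intros z Hz. apply Rminus_diag_eq.
      apply (RInt_open_derive (fun t => P t z)); intros; try now apply cont2_l.
      apply Hd; trivial. revert H. apply Rmin_case; apply Rmax_case; lra. }
  (* The integral identity, now known for the closed range of [y], is differentiated back. *)
  apply is_derive_ext_loc with (fun u => P x y + RInt (fun t => Q t y) x u).
  - assert (He : 0 < Rmin (x - a) (b - x)) by (apply Rmin_pos; lra).
    exists (mkposreal _ He). intros u Hu. change (Rabs (u - x) < Rmin (x - a) (b - x)) in Hu.
    symmetry. apply HI. apply Rabs_def2 in Hu.
    assert (H1 := Rmin_l (x - a) (b - x)). assert (H2 := Rmin_r (x - a) (b - x)). lra.
  - replace (Q x y) with (0 + Q x y) by ring.
    apply (is_derive_plus (fun _ => P x y) (fun u => RInt (fun t => Q t y) x u)).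
    + apply (is_derive_const (V := R_NormedModule)).
    + apply (is_derive_RInt (V := R_NormedModule) (fun t => Q t y)) with x; [|now apply cont2_l].
      exists (mkposreal 1 Rlt_0_1). intros u _. apply (RInt_correct (V := R_CompleteNormedModule)).
      apply ex_RInt_cont. intros t. now apply cont2_l.
Qed.

(** The product [N t * exp (- K * t)] has nonpositive derivative in the open interval and is
    continuous at its ends. *)
Lemma gronwall (N N' : R -> R) (K rmax : R) :
  (forall r, continuous N r) ->
  (forall r, 0 < r < rmax -> is_derive N r (N' r) /\ N' r <= K * N r) ->
  forall r, 0 <= r <= rmax -> N r <= exp (K * r) * N 0.
Proof.
  intros Hc Hd r Hr.
  (* The mean value theorem may return an end point, where nothing is known about [N']; the default
     0 keeps [D c <= 0] there. *)
  set (D t := if Rlt_dec 0 t then if Rlt_dec t rmax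
    then (N' t - K * N t) * exp (- K * t) else 0 else 0).
  destruct (MVT_gen (fun t => N t * exp (- K * t)) 0 r D) as [c [_ Hc2]].
  - rewrite Rmin_left, Rmax_right by lra. intros x Hx.
    destruct (Hd x ltac:(lra)) as [H1 _]. unfold D.
    destruct (Rlt_dec 0 x); [|lra]. destruct (Rlt_dec x rmax); [|lra].
    auto_derive.
    + now exists (N' x).
    + replace (Derive (fun x0 => N x0) x) with (N' x); [ring|].
      symmetry. now apply is_derive_unique.
  - intros x _. apply continuity_pt_filterlim.
    apply (continuous_mult N (fun t => exp (- K * t))); [apply Hc|].
    apply (ex_derive_continuous (fun t => exp (- K * t))). auto_derive. trivial.
  - assert (HD : D c <= 0).
    { unfold D. destruct (Rlt_dec 0 c); [|lra]. destruct (Rlt_dec c rmax); [|lra].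
      destruct (Hd c ltac:(lra)) as [_ H]. assert (He := exp_pos (- K * c)). nra. }
    rewrite Rmult_0_r, exp_0, Rmult_1_r, Rminus_0_r in Hc2.
    assert (HE : N r * exp (- K * r) <= N 0) by nra.
    assert (HEE : exp (- K * r) * exp (K * r) = 1)
      by (rewrite <- exp_plus, <- exp_0; f_equal; ring).
    assert (He := exp_pos (K * r)).
    replace (N r) with (N r * exp (- K * r) * exp (K * r)) by (rewrite Rmult_assoc, HEE; ring).
    rewrite Rmult_comm. apply Rmult_le_compat_l; lra.
Qed.

(** * Continuity and integrability of explicit integrands *)

Lemma cont1_const (c : R) : cont1 (fun _ => c).
Proof. intros x. apply continuous_const. Qed.

Lemma cont1_id : cont1 (fun x => x).
Proof. intros x. apply continuous_id. Qed.

Lemma cont1_plus (f g : R -> R) : cont1 f -> cont1 g -> cont1 (fun x => f x + g x).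
Proof. intros Hf Hg x. now apply (continuous_plus f g). Qed.

Lemma cont1_minus (f g : R -> R) : cont1 f -> cont1 g -> cont1 (fun x => f x - g x).
Proof. intros Hf Hg x. now apply (continuous_minus f g). Qed.

Lemma cont1_mult (f g : R -> R) : cont1 f -> cont1 g -> cont1 (fun x => f x * g x).
Proof. intros Hf Hg x. now apply (continuous_mult f g). Qed.

Lemma cont1_pow (f : R -> R) (n : nat) : cont1 f -> cont1 (fun x => f x ^ n).
Proof.
  intros Hf. induction n as [|n IH]; simpl; [apply cont1_const | now apply cont1_mult].
Qed.

Lemma cont2_pow (f : R -> R -> R) (n : nat) : cont2 f -> cont2 (fun x y => f x y ^ n).
Proof.
  intros Hf. induction n as [|n IH]; simpl; [apply cont2_const | now apply cont2_mult].
Qed.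

Lemma cont2_cont1_l (f : R -> R -> R) (y : R) : cont2 f -> cont1 (fun x => f x y).
Proof. intros Hf x. now apply cont2_l. Qed.

Lemma cont2_cont1_r (f : R -> R -> R) (x : R) : cont2 f -> cont1 (fun y => f x y).
Proof. intros Hf y. now apply cont2_r. Qed.

Lemma cont1_RInt_param (f : R -> R -> R) (a b : R) :
  cont2 f -> cont1 (fun x => RInt (fun y => f x y) a b).
Proof.
  intros Hf x. apply (continuous_RInt_param (fun y x => f x y)). now apply cont2_swap.
Qed.

Ltac cont_step :=
  match goal with
  | H : cont1 ?f |- cont1 ?f => exact H
  | H : cont2 ?f |- cont2 ?f => exact H
  | H : cont1 ?f |- cont1 (fun x => ?f x) => exact H
  | H : cont2 ?f |- cont2 (fun x y => ?f x y) => exact H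
  | H : forall i j, cont2 (?f i j) |- cont2 (?f _ _) => apply H
  | H : forall i j, cont2 (?f i j) |- cont2 (fun x y => ?f _ _ x y) => apply H
  | |- cont1 (fun _ => ?c) => apply (cont1_const c)
  | |- cont2 (fun _ _ => ?c) => apply (cont2_const c)
  | |- cont1 (fun x => x) => apply cont1_id
  | |- cont1 (fun x => @?f x + @?g x) => apply (cont1_plus f g)
  | |- cont1 (fun x => @?f x - @?g x) => apply (cont1_minus f g)
  | |- cont1 (fun x => @?f x * @?g x) => apply (cont1_mult f g)
  | |- cont1 (fun x => @?f x ^ ?n) => apply (cont1_pow f n)
  | |- cont2 (fun x y => @?f x y + @?g x y) => apply (cont2_plus f g)
  | |- cont2 (fun x y => @?f x y - @?g x y) => apply (cont2_minus f g)
  | |- cont2 (fun x y => @?f x y * @?g x y) => apply (cont2_mult f g)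
  | |- cont2 (fun x y => @?f x y ^ ?n) => apply (cont2_pow f n)
  | |- cont1 (fun x => RInt (fun y => @?f x y) ?a ?b) => apply (cont1_RInt_param f a b)
  | |- cont2 (fun x _ => @?f x) => apply (cont2_fst f)
  | |- cont2 (fun _ y => @?f y) => apply (cont2_snd f)
  | |- cont1 (fun x => ?f x ?y) => apply (cont2_cont1_l f y)
  | |- cont1 (fun y => ?f ?x y) => apply (cont2_cont1_r f x)
  | |- cont1 (?f ?x) => apply (cont2_cont1_r f x)
  end.

Ltac cont := repeat cont_step.

Ltac exint := apply ex_RInt_cont; match goal with |- forall x, continuous ?f x => change (cont1 f) end; cont.

Lemma RInt_plus_cont (f g : R -> R) (a b : R) : cont1 f -> cont1 g ->
  RInt (fun x => f x + g x) a b = RInt f a b + RInt g a b.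
Proof. intros Hf Hg. apply (RInt_plus (V := R_CompleteNormedModule)); now exint. Qed.

Lemma RInt_scal_cont (f : R -> R) (c a b : R) : cont1 f ->
  RInt (fun x => c * f x) a b = c * RInt f a b.
Proof. intros Hf. apply (RInt_scal (V := R_CompleteNormedModule)). now exint. Qed.

Lemma RInt_ext_01 (f g : R -> R) :
  (forall x, 0 < x < 1 -> f x = g x) -> RInt f 0 1 = RInt g 0 1.
Proof.
  intros H. apply RInt_ext. now rewrite Rmin_left, Rmax_right by lra.
Qed.

Lemma RInt_le_cont (f g : R -> R) (a b : R) : a <= b -> cont1 f -> cont1 g ->
  (forall x, a < x < b -> f x <= g x) -> RInt f a b <= RInt g a b.
Proof. intros Hab Hf Hg H. apply RInt_le; trivial; exint. Qed.

Lemma is_derive_sqr (f : R -> R) (x l : R) :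
  is_derive f x l -> is_derive (fun t => f t ^ 2) x (2 * f x * l).
Proof.
  intros H. auto_derive; [now exists l|].
  replace (Derive (fun x0 => f x0) x) with l; [ring|]. symmetry. now apply is_derive_unique.
Qed.

(** The projection onto [a, b] when a <= b. Composing with it extends a continuous function from
    [a, b] to the line. *)
Definition clamp (a b x : R) : R := Rmax a (Rmin b x).

Lemma clamp_bounds (a b x : R) : a <= b -> a <= clamp a b x <= b.
Proof. unfold clamp, Rmax, Rmin. repeat destruct Rle_dec; lra. Qed.

Lemma clamp_id (a b x : R) : a <= x <= b -> clamp a b x = x.
Proof. unfold clamp, Rmax, Rmin. repeat destruct Rle_dec; lra. Qed.

Lemma clamp_lipschitz (a b x y : R) : Rabs (clamp a b x - clamp a b y) <= Rabs (x - y).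
Proof.
  unfold clamp, Rmax, Rmin. repeat destruct Rle_dec; apply Rabs_le;
    unfold Rabs; destruct Rcase_abs; lra.
Qed.

Lemma cont1_clamp (a b : R) : cont1 (clamp a b).
Proof.
  intros x. apply continuity_pt_filterlim, continuity_pt_locally. intros eps.
  exists eps. intros u Hu. eapply Rle_lt_trans; [apply clamp_lipschitz | exact Hu].
Qed.

Lemma locally_open (a b x : R) (P : R -> Prop) :
  a < x < b -> (forall t, a < t < b -> P t) -> locally x P.
Proof.
  intros Hx HP.
  assert (He : 0 < Rmin (x - a) (b - x)) by (apply Rmin_pos; lra).
  exists (mkposreal _ He). intros u Hu. change (Rabs (u - x) < Rmin (x - a) (b - x)) in Hu.
  apply HP. apply Rabs_def2 in Hu.
  assert (H1 := Rmin_l (x - a) (b - x)). assert (H2 := Rmin_r (x - a) (b - x)). lra.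
Qed.

(* The Reynolds transport formula on the fixed interval: the term
   [s' y g_z] coming from the change of variables is integrated by parts. *)
Lemma is_derive_energy (s s1 : R -> R) (A Ar Az : R -> R -> R) (rmax : R) :
  cont2 A -> cont2 Ar -> cont2 Az -> cont1 s1 -> cont1 s ->
  (forall r, 0 < r < rmax -> is_derive s r (s1 r)) ->
  (forall r y, 0 < r < rmax -> 0 < y < 1 ->
     is_derive (fun y => A r y) y (s r * Az r y)) ->
  (forall r y, 0 < r < rmax ->
     is_derive (fun r => A r y) r (Ar r y + s1 r * clamp 0 1 y * Az r y)) ->
  forall r, 0 < r < rmax ->
    is_derive (fun r => s r * RInt (fun y => A r y ^ 2) 0 1) r
      (s1 r * A r 1 ^ 2 + s r * RInt (fun y => 2 * A r y * Ar r y) 0 1).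
Proof.
  intros HA HAr HAz Hs1 Hsc Hs Hz Hr r Hr0.
  assert (Hcl := cont1_clamp 0 1).
  (* The r-derivative of [A^2] at fixed [y], that is, along the moving point z = s(r) y. *)
  set (H u y := 2 * A u y * (Ar u y + s1 u * clamp 0 1 y * Az u y)).
  assert (HH : cont2 H) by (unfold H; cont).
  assert (HdH : forall u y, 0 < u < rmax -> is_derive (fun r => A r y ^ 2) u (H u y))
    by (intros u y Hu; apply (is_derive_sqr (fun r => A r y)), Hr; trivial).
  assert (HI : is_derive (fun r => RInt (fun y => A r y ^ 2) 0 1) r (RInt (fun y => H r y) 0 1)).
  { replace (RInt (fun y => H r y) 0 1)
      with (RInt (fun t => Derive (fun u => A u t ^ 2) r) 0 1)
      by (apply RInt_ext; intros t _; now apply is_derive_unique, HdH).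
    apply is_derive_RInt_param.
    - apply (locally_open 0 rmax); trivial. intros u Hu t _. exists (H u t). now apply HdH.
    - intros t _. apply continuity_2d_pt_ext_loc with (f := H); [|apply HH].
      destruct (locally_open 0 rmax r (fun u => 0 < u < rmax) Hr0 ltac:(auto)) as [e He].
      exists e. intros u v Hu _. symmetry. now apply is_derive_unique, HdH, He.
    - apply (locally_open 0 rmax); trivial. intros u _. exint. }
  (* The derivative of [y * A^2] integrated over [0, 1]: the factor [y] leaves only the trace at y =
     1. *)
  assert (HP : A r 1 ^ 2 = RInt (fun y => A r y ^ 2 + y * (2 * A r y * (s r * Az r y))) 0 1).
  { rewrite <- (RInt_open_derive (fun y => y * A r y ^ 2)); [ring | | |].
    - change (cont1 (fun y => y * A r y ^ 2)). cont.
    - change (cont1 (fun y => A r y ^ 2 + y * (2 * A r y * (s r * Az r y)))). cont.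
    - rewrite Rmin_left, Rmax_right by lra. intros y Hy.
      assert (D := is_derive_sqr _ _ _ (Hz r y Hr0 Hy)).
      assert (D' := is_derive_mult (fun y => y) _ y 1 _ (is_derive_id y) D Rmult_comm).
      cbv beta in D'. unfold mult, plus in D'; simpl in D'.
      evar_last; [exact D'|]. simpl. ring. }
  evar_last.
  { apply (is_derive_mult s); [now apply Hs | exact HI | exact Rmult_comm]. }
  unfold plus, mult; simpl.
  set (J y := 2 * A r y * (y * Az r y)).
  assert (HJ : cont1 J) by (unfold J; cont).
  assert (H1 : RInt (fun y => H r y) 0 1
    = RInt (fun y => 2 * A r y * Ar r y) 0 1 + s1 r * RInt J 0 1).
  { rewrite <- RInt_scal_cont, <- RInt_plus_cont by cont.
    apply RInt_ext_01. intros y Hy. unfold H, J. rewrite clamp_id by lra. ring. }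
  assert (H2 : A r 1 ^ 2 = RInt (fun y => A r y ^ 2) 0 1 + s r * RInt J 0 1).
  { rewrite HP, <- RInt_scal_cont, <- RInt_plus_cont by cont.
    apply RInt_ext_01. intros y _. unfold J. ring. }
  simpl pow in H1, H2. rewrite H1, H2. ring.
Qed.

Lemma is_derive_multR (f g : R -> R) (x l m : R) :
  is_derive f x l -> is_derive g x m ->
  is_derive (fun t => f t * g t) x (l * g x + f x * m).
Proof. intros Hf Hg. exact (is_derive_mult f g x l m Hf Hg Rmult_comm). Qed.

Lemma is_derive_plusR (f g : R -> R) (x l m : R) :
  is_derive f x l -> is_derive g x m -> is_derive (fun t => f t + g t) x (l + m).
Proof. intros Hf Hg. exact (is_derive_plus f g x l m Hf Hg). Qed.

Lemma is_derive_minusR (f g : R -> R) (x l m : R) :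
  is_derive f x l -> is_derive g x m -> is_derive (fun t => f t - g t) x (l - m).
Proof. intros Hf Hg. exact (is_derive_minus f g x l m Hf Hg). Qed.

Lemma is_derive_scalR (f : R -> R) (c x l : R) :
  is_derive f x l -> is_derive (fun t => c * f t) x (c * l).
Proof. intros Hf. exact (is_derive_scal f x c l Hf). Qed.

Lemma is_derive_idR (x : R) : is_derive (fun t : R => t) x 1.
Proof. apply (is_derive_id (K := R_AbsRing)). Qed.

Lemma is_derive_constR (c x : R) : is_derive (fun _ : R => c) x 0.
Proof. apply (is_derive_const (K := R_AbsRing) (V := R_NormedModule)). Qed.

(** The common form of the integrations by parts below: [f] is the boundary expression, and its
    derivative is bounded pointwise by the integrand of the desired inequality. *)
Lemma increment_le (f df g : R -> R) :
  cont1 f -> cont1 df -> cont1 g ->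
  (forall y, 0 < y < 1 -> is_derive f y (df y)) ->
  (forall y, 0 < y < 1 -> df y <= g y) ->
  f 1 - f 0 <= RInt g 0 1.
Proof.
  intros Hf Hdf Hg Hd Hle. rewrite (RInt_open_derive f df) by
    (trivial; rewrite Rmin_left, Rmax_right by lra; trivial).
  apply RInt_le_cont; trivial; lra.
Qed.

(** * The Dirichlet problem on a slice *)

Lemma sum_sqr_ge_0 (x y : R) : 0 <= x ^ 2 + y ^ 2.
Proof. assert (H := pow2_ge_0 x). assert (K := pow2_ge_0 y). lra. Qed.

(** The squared L^2 norm of a + i b in the variable y; the norm on [0, s] has an additional factor
    s. *)
Definition sqint (a b : R -> R) : R := RInt (fun y => a y ^ 2 + b y ^ 2) 0 1.

Lemma sqint_pos (a b : R -> R) : cont1 a -> cont1 b -> 0 <= sqint a b.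
Proof.
  intros Ha Hb. apply RInt_ge_0; [lra | exint |]. intros; apply sum_sqr_ge_0.
Qed.

Lemma RInt_sqint2 (p p' : R) (a a' b b' : R -> R) :
  cont1 a -> cont1 b -> cont1 a' -> cont1 b' ->
  RInt (fun y => p * (a y ^ 2 + b y ^ 2) + p' * (a' y ^ 2 + b' y ^ 2)) 0 1
  = p * sqint a b + p' * sqint a' b'.
Proof.
  intros. unfold sqint.
  rewrite <- !RInt_scal_cont, <- RInt_plus_cont by cont. reflexivity.
Qed.

(* [w = a + i b] solves [gamma w + alpha^2 w_zz = h] with [gamma = g1 + i g2],
   [h = k + i l] and Dirichlet conditions on [0, s], in the variable [y = z / s];
   [a1], [a2] stand for the derivatives [a_z], [a_zz]. *)
Record dirichlet (s alpha : R) (g1 g2 k l a a1 a2 b b1 b2 : R -> R) : Prop := {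
  dir_s : 0 < s;
  dir_alpha : 0 < alpha;
  dir_g1 : cont1 g1; dir_g2 : cont1 g2; dir_k : cont1 k; dir_l : cont1 l;
  dir_a : cont1 a; dir_a1 : cont1 a1; dir_a2 : cont1 a2;
  dir_b : cont1 b; dir_b1 : cont1 b1; dir_b2 : cont1 b2;
  dir_da : forall y, 0 < y < 1 -> is_derive a y (s * a1 y);
  dir_da1 : forall y, 0 < y < 1 -> is_derive a1 y (s * a2 y);
  dir_db : forall y, 0 < y < 1 -> is_derive b y (s * b1 y);
  dir_db1 : forall y, 0 < y < 1 -> is_derive b1 y (s * b2 y);
  dir_0 : a 0 = 0 /\ b 0 = 0 /\ a 1 = 0 /\ b 1 = 0;
  dir_re : forall y, 0 < y < 1 -> g1 y * a y - g2 y * b y + alpha ^ 2 * a2 y = k y;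
  dir_im : forall y, 0 < y < 1 -> g1 y * b y + g2 y * a y + alpha ^ 2 * b2 y = l y
}.

(** The imaginary part of w_zz times the conjugate of w is the z-derivative of [b1 a - a1 b], which
    vanishes at both ends; the real part of gamma cancels. The sign of Im gamma is carried by [e],
    equal to 1 or -1, and the datum is absorbed by Young's inequality with weight [c]. *)
Lemma coercive_im (s alpha : R) (g1 g2 k l a a1 a2 b b1 b2 : R -> R) (e c : R) :
  dirichlet s alpha g1 g2 k l a a1 a2 b b1 b2 ->
  0 < c -> e ^ 2 = 1 -> (forall y, 0 < y < 1 -> c <= e * g2 y) ->
  sqint a b <= / c ^ 2 * sqint k l.
Proof.
  intros [Hs Hal Hg1 Hg2 Hk Hl Ha Ha1 Ha2 Hb Hb1 Hb2 Da Da1 Db Db1 H0 Hre Him] Hc He Hg.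
  assert (K := increment_le (fun y => e * (alpha ^ 2 * (b1 y * a y - a1 y * b y)))
    (fun y => e * (alpha ^ 2 * (s * (b2 y * a y - a2 y * b y))))
    (fun y => - (s * c / 2) * (a y ^ 2 + b y ^ 2) + s / (2 * c) * (k y ^ 2 + l y ^ 2))).
  rewrite RInt_sqint2 in K by trivial.
  destruct H0 as (H1 & H2 & H3 & H4). cbv beta in K. rewrite H1, H2, H3, H4 in K.
  assert (K' : 0 <= - (s * c / 2) * sqint a b + s / (2 * c) * sqint k l).
  { eapply Rle_trans; [|apply K; try cont].
    - right; ring.
    - intros y Hy. evar_last.
      + do 2 apply is_derive_scalR. apply is_derive_minusR; apply is_derive_multR; auto.
      + ring.
    - intros y Hy. specialize (Hre y Hy); specialize (Him y Hy); specialize (Hg y Hy).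
      replace (e * (alpha ^ 2 * (s * (b2 y * a y - a2 y * b y)))) with
        (s * (e * (l y * a y - k y * b y) - (e * g2 y) * (a y ^ 2 + b y ^ 2)))
        by (rewrite <- Hre, <- Him; ring).
      replace (- (s * c / 2) * (a y ^ 2 + b y ^ 2) + s / (2 * c) * (k y ^ 2 + l y ^ 2))
        with (s * (- (c / 2) * (a y ^ 2 + b y ^ 2) + / (2 * c) * (k y ^ 2 + l y ^ 2)))
        by (field; lra).
      apply Rmult_le_compat_l; [lra|].
      assert (P1 : 0 <= (e * g2 y - c) * (a y ^ 2 + b y ^ 2)) by (apply Rmult_le_pos; [lra | apply sum_sqr_ge_0]).
      (* Young's inequality as a complete square; [e ^ 2 = 1] removes the sign from its diagonal
         term. *)
      assert (P2 : 0 <= / (2 * c) * ((e * c * a y - l y) ^ 2 + (e * c * b y + k y) ^ 2)).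
      { apply Rmult_le_pos; [apply Rlt_le, Rinv_0_lt_compat; lra | apply sum_sqr_ge_0]. }
      replace (/ (2 * c) * ((e * c * a y - l y) ^ 2 + (e * c * b y + k y) ^ 2))
        with (e ^ 2 * (c / 2) * (a y ^ 2 + b y ^ 2) + / (2 * c) * (k y ^ 2 + l y ^ 2)
              - e * (l y * a y - k y * b y)) in P2 by (field; lra).
      rewrite He in P2. lra. }
  replace (- (s * c / 2) * sqint a b + s / (2 * c) * sqint k l)
    with (s * c / 2 * (/ c ^ 2 * sqint k l - sqint a b)) in K' by (field; lra).
  assert (0 < s * c / 2) by nra. nra.
Qed.

(** Real part of the equation tested with the conjugate of w: [alpha^2 |w_z|^2] integrates to the
    integral of [g1 |w|^2] minus that of the real part of h times the conjugate of w. Young's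
    inequality with weights 1/2 gives the constants. No sign of Im gamma enters, so the bound serves
    both cases of the theorem. *)
Lemma gradient_le (s alpha : R) (g1 g2 k l a a1 a2 b b1 b2 : R -> R) (G : R) :
  dirichlet s alpha g1 g2 k l a a1 a2 b b1 b2 ->
  0 <= G -> (forall y, 0 < y < 1 -> g1 y ^ 2 + g2 y ^ 2 <= G ^ 2) ->
  alpha ^ 2 * sqint a1 b1 <= (G + / 2) * sqint a b + / 2 * sqint k l.
Proof.
  intros [Hs Hal Hg1 Hg2 Hk Hl Ha Ha1 Ha2 Hb Hb1 Hb2 Da Da1 Db Db1 H0 Hre Him] HG Hg.
  assert (K := increment_le (fun y => - alpha ^ 2 * (a1 y * a y + b1 y * b y))
    (fun y => - alpha ^ 2 * (s * (a2 y * a y + b2 y * b y + (a1 y ^ 2 + b1 y ^ 2))))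
    (fun y => (s * (G + / 2) * (a y ^ 2 + b y ^ 2) + s * / 2 * (k y ^ 2 + l y ^ 2))
       + - (s * alpha ^ 2) * (a1 y ^ 2 + b1 y ^ 2))).
  rewrite RInt_plus_cont, RInt_sqint2, RInt_scal_cont in K by cont.
  destruct H0 as (H1 & H2 & H3 & H4). cbv beta in K. rewrite H1, H2, H3, H4 in K.
  fold (sqint a1 b1) in K.
  assert (K' : 0 <= s * ((G + / 2) * sqint a b + / 2 * sqint k l - alpha ^ 2 * sqint a1 b1)).
  { eapply Rle_trans; [|eapply Rle_trans; [apply K; try cont|]].
    - right; ring.
    - intros y Hy. evar_last.
      + apply is_derive_scalR, is_derive_plusR; apply is_derive_multR; auto.
      + ring.
    - intros y Hy. specialize (Hre y Hy); specialize (Him y Hy); specialize (Hg y Hy).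
      replace (- alpha ^ 2 * (s * (a2 y * a y + b2 y * b y + (a1 y ^ 2 + b1 y ^ 2)))) with
        (s * (g1 y * (a y ^ 2 + b y ^ 2) - (k y * a y + l y * b y))
         + - (s * alpha ^ 2) * (a1 y ^ 2 + b1 y ^ 2))
        by (rewrite <- Hre, <- Him; ring).
      apply Rplus_le_compat_r. rewrite !(Rmult_assoc s), <- Rmult_plus_distr_l.
      apply Rmult_le_compat_l; [lra|].
      assert (HgG : g1 y <= G).
      { apply Rnot_lt_le. intros Hn. assert (Hg2' := pow2_ge_0 (g2 y)).
        assert (0 < (g1 y - G) * (g1 y + G)) by (apply Rmult_lt_0_compat; lra). lra. }
      assert (P : 0 <= (G - g1 y) * (a y ^ 2 + b y ^ 2))
        by (apply Rmult_le_pos; [lra | apply sum_sqr_ge_0]).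
      assert (P2 := sum_sqr_ge_0 (k y + a y) (l y + b y)). lra.
    - right; ring. }
  nra.
Qed.

(** The weight [1 - y] removes the boundary term at y = 1, and [a 0 = 0] the one at y = 0. Young's
    inequality then absorbs half of the integral of [a^2], whence the factor 4. *)
Lemma poincare_aux (s : R) (a a1 : R -> R) :
  0 < s -> cont1 a -> cont1 a1 -> a 0 = 0 ->
  (forall y, 0 < y < 1 -> is_derive a y (s * a1 y)) ->
  RInt (fun y => a y ^ 2) 0 1 <= 4 * s ^ 2 * RInt (fun y => a1 y ^ 2) 0 1.
Proof.
  intros Hs Ha Ha1 H0 Da.
  assert (K := increment_le (fun y => (1 - y) * a y ^ 2)
    (fun y => -1 * a y ^ 2 + (1 - y) * (2 * a y * (s * a1 y)))
    (fun y => - / 2 * a y ^ 2 + 2 * s ^ 2 * a1 y ^ 2)).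
  rewrite RInt_plus_cont, !RInt_scal_cont in K by cont. cbv beta in K. rewrite H0 in K.
  match type of K with _ -> _ -> _ -> _ -> _ -> ?c => cut c end; [lra|].
  apply K; try cont.
  - intros y Hy. evar_last.
    + apply is_derive_multR; [apply is_derive_minusR; [apply is_derive_constR | apply is_derive_idR]
        | apply is_derive_sqr; auto].
    + simpl. ring.
  - intros y Hy.
    assert (P := pow2_ge_0 (a y - 2 * (1 - y) * (s * a1 y))).
    assert (P1 : 0 <= (s * a1 y) ^ 2 * (1 - (1 - y) ^ 2))
      by (apply Rmult_le_pos; [apply pow2_ge_0 | nra]).
    nra.
Qed.

Lemma poincare (s alpha : R) (g1 g2 k l a a1 a2 b b1 b2 : R -> R) :
  dirichlet s alpha g1 g2 k l a a1 a2 b b1 b2 ->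
  sqint a b <= 4 * s ^ 2 * sqint a1 b1.
Proof.
  intros [Hs Hal Hg1 Hg2 Hk Hl Ha Ha1 Ha2 Hb Hb1 Hb2 Da Da1 Db Db1 H0 Hre Him].
  unfold sqint. rewrite !RInt_plus_cont by cont.
  assert (P := poincare_aux s a a1 Hs Ha Ha1 ltac:(tauto) Da).
  assert (Q := poincare_aux s b b1 Hs Hb Hb1 ltac:(tauto) Db). lra.
Qed.

(** Poincare's inequality and [gradient_le] bound [4 (G + 1)^2 |w|^2] by
    [(G + 1/2) |w|^2 + 1/2 |h|^2] in the mean. The threshold on s / alpha is chosen so that the left
    coefficient exceeds the right one by at least 1/2. *)
Lemma coercive_small (s alpha : R) (g1 g2 k l a a1 a2 b b1 b2 : R -> R) (G : R) :
  dirichlet s alpha g1 g2 k l a a1 a2 b b1 b2 ->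
  0 <= G -> (forall y, 0 < y < 1 -> g1 y ^ 2 + g2 y ^ 2 <= G ^ 2) ->
  / alpha * s <= / (4 * (G + 1)) ->
  sqint a b <= sqint k l.
Proof.
  intros D HG Hg Hs.
  assert (P := poincare _ _ _ _ _ _ _ _ _ _ _ _ D).
  assert (Q := gradient_le _ _ _ _ _ _ _ _ _ _ _ _ G D HG Hg).
  destruct D as [Hs0 Hal Hg1 Hg2 Hk Hl Ha Ha1 Ha2 Hb Hb1 Hb2 _ _ _ _ _ _ _].
  assert (W := sqint_pos a b Ha Hb). assert (W1 := sqint_pos a1 b1 Ha1 Hb1).
  assert (H := sqint_pos k l Hk Hl).
  assert (Hsa : 4 * (G + 1) * s <= alpha).
  { replace (4 * (G + 1) * s) with (4 * (G + 1) * alpha * (/ alpha * s)) by (field; lra).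
    replace alpha with (4 * (G + 1) * alpha * / (4 * (G + 1))) at 3 by (field; lra).
    apply Rmult_le_compat_l; nra. }
  assert (Hsa2 : (4 * (G + 1)) ^ 2 * s ^ 2 <= alpha ^ 2) by (rewrite <- Rpow_mult_distr; apply pow_incr; nra).
  assert (Q2 : 16 * (G + 1) ^ 2 * (s ^ 2 * sqint a1 b1) <= (G + / 2) * sqint a b + / 2 * sqint k l).
  { eapply Rle_trans; [|apply Q].
    replace (16 * (G + 1) ^ 2 * (s ^ 2 * sqint a1 b1))
      with ((4 * (G + 1)) ^ 2 * s ^ 2 * sqint a1 b1) by ring. now apply Rmult_le_compat_r. }
  assert (Q3 : 4 * (G + 1) ^ 2 * sqint a b <= (G + / 2) * sqint a b + / 2 * sqint k l).
  { eapply Rle_trans; [|apply Q2].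
    replace (16 * (G + 1) ^ 2 * (s ^ 2 * sqint a1 b1))
      with (4 * (G + 1) ^ 2 * (4 * s ^ 2 * sqint a1 b1)) by ring.
    apply Rmult_le_compat_l; nra. }
  nra.
Qed.

(** The equation is solved for [alpha^2 w_zz = h - gamma w], pointwise. *)
Lemma second_derivative_le (s alpha : R) (g1 g2 k l a a1 a2 b b1 b2 : R -> R) (G : R) :
  dirichlet s alpha g1 g2 k l a a1 a2 b b1 b2 ->
  (forall y, 0 < y < 1 -> g1 y ^ 2 + g2 y ^ 2 <= G ^ 2) ->
  alpha ^ 4 * sqint a2 b2 <= 2 * G ^ 2 * sqint a b + 2 * sqint k l.
Proof.
  intros [Hs Hal Hg1 Hg2 Hk Hl Ha Ha1 Ha2 Hb Hb1 Hb2 Da Da1 Db Db1 H0 Hre Him] Hg.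
  rewrite <- RInt_sqint2 by trivial. unfold sqint. rewrite <- RInt_scal_cont by cont.
  apply RInt_le_cont; try cont; try lra.
  intros y Hy. specialize (Hre y Hy); specialize (Him y Hy); specialize (Hg y Hy).
  replace (alpha ^ 4 * (a2 y ^ 2 + b2 y ^ 2)) with
    ((k y - (g1 y * a y - g2 y * b y)) ^ 2 + (l y - (g1 y * b y + g2 y * a y)) ^ 2)
    by (rewrite <- Hre, <- Him; ring).
  assert (P : 0 <= (G ^ 2 - (g1 y ^ 2 + g2 y ^ 2)) * (a y ^ 2 + b y ^ 2)) by (apply Rmult_le_pos; [lra | apply sum_sqr_ge_0]).
  assert (P1 := pow2_ge_0 (k y + (g1 y * a y - g2 y * b y))).
  assert (P2 := pow2_ge_0 (l y + (g1 y * b y + g2 y * a y))).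
  nra.
Qed.

(** The primitive [y |w_z|^2] vanishes at y = 0 and equals the trace at y = 1. *)
Lemma trace_le (s : R) (a1 a2 b1 b2 : R -> R) :
  0 < s -> cont1 a1 -> cont1 a2 -> cont1 b1 -> cont1 b2 ->
  (forall y, 0 < y < 1 -> is_derive a1 y (s * a2 y)) ->
  (forall y, 0 < y < 1 -> is_derive b1 y (s * b2 y)) ->
  a1 1 ^ 2 + b1 1 ^ 2 <= (1 + s) * sqint a1 b1 + s * sqint a2 b2.
Proof.
  intros Hs Ha1 Ha2 Hb1 Hb2 Da Db.
  assert (K := increment_le (fun y => y * (a1 y ^ 2 + b1 y ^ 2))
    (fun y => 1 * (a1 y ^ 2 + b1 y ^ 2) + y * (2 * a1 y * (s * a2 y) + 2 * b1 y * (s * b2 y)))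
    (fun y => (1 + s) * (a1 y ^ 2 + b1 y ^ 2) + s * (a2 y ^ 2 + b2 y ^ 2))).
  rewrite RInt_sqint2 in K by trivial.
  rewrite Rmult_0_l, Rmult_1_l, Rminus_0_r in K.
  apply K; try cont.
  - intros y Hy. evar_last.
    + apply is_derive_multR; [apply is_derive_idR|].
      apply is_derive_plusR; apply is_derive_sqr; auto.
    + simpl. ring.
  - intros y Hy.
    assert (P : forall u v, y * (2 * u * (s * v)) <= s * (u ^ 2 + v ^ 2)).
    { intros u v. replace (y * (2 * u * (s * v))) with (s * (y * (2 * u * v))) by ring.
      apply Rmult_le_compat_l; [lra|].
      assert (0 <= y * (u - v) ^ 2) by (apply Rmult_le_pos; [lra | apply pow2_ge_0]).
      assert (0 <= (1 - y) * (u ^ 2 + v ^ 2)) by (apply Rmult_le_pos; [lra | apply sum_sqr_ge_0]).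
      lra. }
    assert (P1 := P (a1 y) (a2 y)). assert (P2 := P (b1 y) (b2 y)). lra.
Qed.

(** * Flattening the domain *)

Definition extend (rmax : R) (s : R -> R) (r : R) : R := s (clamp 0 rmax r).

(* [f] in the coordinates [(r, y)] with [z = s(r) y], extended from
   [0, rmax] x [0, 1] to the plane by projecting the coordinates. *)
Definition pull (rmax : R) (s : R -> R) (f : R -> R -> R) (r y : R) : R :=
  f (clamp 0 rmax r) (extend rmax s r * clamp 0 1 y).

Lemma extend_id (rmax : R) (s : R -> R) (r : R) :
  0 <= r <= rmax -> extend rmax s r = s r.
Proof. intros Hr. unfold extend. now rewrite clamp_id. Qed.

Lemma extend_open (rmax : R) (s : R -> R) (r : R) :
  0 < r < rmax -> locally r (fun t => s t = extend rmax s t).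
Proof.
  intros Hr. apply (locally_open 0 rmax); trivial. intros t Ht.
  rewrite extend_id; trivial; lra.
Qed.

Lemma cont1_extend (rmax : R) (s : R -> R) :
  0 < rmax -> continuous_on (fun r => 0 <= r <= rmax) s -> cont1 (extend rmax s).
Proof.
  intros Hrm Hs x. apply continuity_pt_filterlim, continuity_pt_locally. intros eps.
  assert (Hc := clamp_bounds 0 rmax x ltac:(lra)).
  assert (H := Hs _ Hc (ball (s (clamp 0 rmax x)) eps) (locally_ball _ _)).
  destruct H as [d Hd]. exists d. intros u Hu.
  apply Hd.
  - change (Rabs (clamp 0 rmax u - clamp 0 rmax x) < d).
    eapply Rle_lt_trans; [apply clamp_lipschitz | exact Hu].
  - apply clamp_bounds. lra.
Qed.

Definition cont_dom (rmax : R) (s : R -> R) (f : R -> R -> R) : Prop :=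
  continuous_on (T := prod_UniformSpace R_UniformSpace R_UniformSpace)
    (U := R_UniformSpace)
    (fun x => dom rmax s (fst x) (snd x)) (fun x => f (fst x) (snd x)).

Lemma pull_dom (rmax : R) (s : R -> R) (r y : R) :
  0 < rmax -> (forall r, 0 <= r <= rmax -> 0 < s r) ->
  dom rmax s (clamp 0 rmax r) (extend rmax s r * clamp 0 1 y).
Proof.
  intros Hrm Hs. unfold extend.
  assert (Hr := clamp_bounds 0 rmax r ltac:(lra)).
  assert (Hy := clamp_bounds 0 1 y ltac:(lra)).
  assert (H := Hs _ Hr). split; trivial. nra.
Qed.

Lemma cont2_pull (rmax : R) (s : R -> R) (f : R -> R -> R) :
  0 < rmax -> (forall r, 0 <= r <= rmax -> 0 < s r) -> cont1 (extend rmax s) ->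
  cont_dom rmax s f -> cont2 (pull rmax s f).
Proof.
  intros Hrm Hs Hc Hf x y eps.
  assert (Hcl := cont1_clamp 0 1). assert (Hclr := cont1_clamp 0 rmax).
  assert (H := Hf (clamp 0 rmax x, extend rmax s x * clamp 0 1 y) (pull_dom _ _ x y Hrm Hs)
    (ball (pull rmax s f x y) eps) (locally_ball _ _)).
  destruct H as [d Hd].
  assert (K1 : cont2 (fun r _ => clamp 0 rmax r)) by cont.
  assert (K2 : cont2 (fun r y => extend rmax s r * clamp 0 1 y)) by cont.
  apply locally_2d_impl with (2 := locally_2d_and _ _ _ _ (K1 x y d) (K2 x y d)).
  apply locally_2d_forall. intros u v [H1 H2].
  apply (Hd (clamp 0 rmax u, extend rmax s u * clamp 0 1 v)).
  - split; [exact H1 | exact H2].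
  - now apply pull_dom.
Qed.

Lemma dom_interior (rmax : R) (s : R -> R) (r z : R) :
  cont1 (extend rmax s) -> 0 < r < rmax -> 0 < z < s r -> locally_2d (dom rmax s) r z.
Proof.
  intros Hc Hr Hz.
  assert (K1 : cont2 (fun r z => extend rmax s r - z)) by cont.
  assert (K2 : cont2 (fun r z => z)) by cont.
  assert (K3 : cont2 (fun r z : R => r)) by cont.
  assert (E := extend_id rmax s r ltac:(lra)).
  assert (P1 : 0 < s r - z) by lra. assert (P2 : 0 < Rmin r (rmax - r)) by (apply Rmin_pos; lra).
  assert (P3 : 0 < z) by lra.
  apply locally_2d_impl with (2 := locally_2d_and _ _ _ _ (K1 r z (mkposreal _ P1))
    (locally_2d_and _ _ _ _ (K2 r z (mkposreal _ P3)) (K3 r z (mkposreal _ P2)))).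
  apply locally_2d_forall. simpl. intros u v (H1 & H2 & H3).
  apply Rabs_def2 in H1, H2, H3.
  assert (M1 := Rmin_l r (rmax - r)). assert (M2 := Rmin_r r (rmax - r)).
  rewrite (extend_id rmax s u) in H1 by lra. rewrite E in H1. split; lra.
Qed.

(** The chain rule covers 0 < r < rmax. The end points are reached by [is_derive_closed] with the
    two variables exchanged; r = 0 is needed to identify the norms of the initial value. *)
Lemma is_derive_pull_y (rmax : R) (s : R -> R) (f fz : R -> R -> R) :
  0 < rmax -> (forall r, 0 <= r <= rmax -> 0 < s r) -> cont1 (extend rmax s) ->
  cont_dom rmax s f -> cont_dom rmax s fz ->
  (forall r z, locally_2d (dom rmax s) r z -> is_derive (fun t => f r t) z (fz r z)) ->
  forall r y, 0 <= r <= rmax -> 0 < y < 1 ->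
    is_derive (fun y => pull rmax s f r y) y (extend rmax s r * pull rmax s fz r y).
Proof.
  intros Hrm Hs Hc Hf Hfz Hd r y Hr Hy.
  assert (Kf := cont2_pull _ _ _ Hrm Hs Hc Hf). assert (Kz := cont2_pull _ _ _ Hrm Hs Hc Hfz).
  apply (is_derive_closed (fun y r => pull rmax s f r y)
    (fun y r => extend rmax s r * pull rmax s fz r y) 0 1 0 rmax); trivial.
  - now apply cont2_swap.
  - cont. now apply cont2_swap.
  - clear r y Hr Hy. intros y r Hy Hr.
    assert (E : 0 < s r) by (apply Hs; lra).
    apply is_derive_ext_loc with (fun y => f r (s r * y)).
    + apply (locally_open 0 1); trivial. intros t Ht. unfold pull.
      rewrite extend_id, !clamp_id by lra. reflexivity.
    + unfold pull. rewrite extend_id, !clamp_id by lra.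
      apply (is_derive_comp (fun z => f r z) (fun y => s r * y)).
      * apply Hd, dom_interior; trivial. nra.
      * evar_last; [apply is_derive_scalR, is_derive_idR | ring].
Qed.

(** The chain rule along z = s(r) y produces the term s' y f_z. Closing up at y = 1 yields the
    derivative along the free boundary, where the jet itself has no derivative relation. *)
Lemma is_derive_pull_r (rmax : R) (s s1 : R -> R) (f fr fz : R -> R -> R) :
  0 < rmax -> (forall r, 0 <= r <= rmax -> 0 < s r) ->
  cont1 (extend rmax s) -> cont1 (extend rmax s1) ->
  (forall r, 0 < r < rmax -> is_derive s r (s1 r)) ->
  cont_dom rmax s f -> cont_dom rmax s fr -> cont_dom rmax s fz ->
  (forall r z, locally_2d (dom rmax s) r z -> is_derive (fun t => f t z) r (fr r z)) ->
  (forall r z, locally_2d (dom rmax s) r z -> is_derive (fun t => f r t) z (fz r z)) ->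
  forall r y, 0 < r < rmax ->
    is_derive (fun r => pull rmax s f r y) r
      (pull rmax s fr r y + extend rmax s1 r * clamp 0 1 y * pull rmax s fz r y).
Proof.
  intros Hrm Hs Hc Hc1 Hs1 Hf Hfr Hfz Hdr Hdz r y Hr.
  assert (Kf := cont2_pull _ _ _ Hrm Hs Hc Hf). assert (Kz := cont2_pull _ _ _ Hrm Hs Hc Hfz).
  assert (Kr := cont2_pull _ _ _ Hrm Hs Hc Hfr).
  assert (Hcl := cont1_clamp 0 1).
  assert (W : forall y, 0 <= y <= 1 -> is_derive (fun r => pull rmax s f r y) r
      (pull rmax s fr r y + extend rmax s1 r * clamp 0 1 y * pull rmax s fz r y)).
  { clear y. intros y Hy.
    apply (is_derive_closed (pull rmax s f) (fun r y => pull rmax s fr r y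
      + extend rmax s1 r * clamp 0 1 y * pull rmax s fz r y) 0 rmax 0 1); trivial.
    - lra.
    - cont.
    - clear r y Hr Hy. intros r y Hr Hy.
      assert (E : 0 < s r) by (apply Hs; lra).
      apply is_derive_ext_loc with (fun r => f r (s r * y)).
      + apply (locally_open 0 rmax); trivial. intros t Ht. unfold pull.
        rewrite extend_id, !clamp_id by lra. reflexivity.
      + assert (HD : locally_2d (dom rmax s) r (s r * y)) by (apply dom_interior; trivial; nra).
        unfold pull. rewrite !extend_id, !clamp_id by lra.
        apply is_derive_Reals. evar_last.
        * apply (derivable_pt_lim_comp_2d f (fun r => r) (fun r => s r * y) r (fr r (s r * y))
            (fz r (s r * y)) 1 (s1 r * y)).
          (* Total differentiability follows from the r-derivative near the point, its continuity
             there, and the z-derivative at the point. *)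
          -- apply filterdiff_differentiable_pt_lim.
             apply filterdiff_ext_lin with
               (fun u => plus (scal (fst u) (fr r (s r * y))) (scal (snd u) (fz r (s r * y))));
               [|reflexivity].
             apply locally_2d_locally in HD.
             apply is_derive_filterdiff.
             ++ apply locally_locally in HD. revert HD. apply filter_imp. intros [u v] Huv.
                apply Hdr. now apply locally_2d_locally.
             ++ apply Hdz. now apply locally_2d_locally.
             ++ now apply (continuous_continuous_on _ _ _ HD).
          -- apply derivable_pt_lim_id.
          -- apply is_derive_Reals. evar_last;
               [apply is_derive_multR; [now apply Hs1 | apply is_derive_constR] | simpl; ring].
        * ring. }
  (* For arbitrary [y], all three pulled functions depend on [y] only through its projection to
     [0, 1]. *)
  assert (Hy := clamp_bounds 0 1 y ltac:(lra)).
  assert (Hyy := clamp_id 0 1 (clamp 0 1 y) Hy).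
  apply is_derive_ext with (fun r => pull rmax s f r (clamp 0 1 y)).
  - intros t. unfold pull. now rewrite Hyy.
  - replace (pull rmax s fr r y) with (pull rmax s fr r (clamp 0 1 y))
      by (unfold pull; now rewrite Hyy).
    replace (pull rmax s fz r y) with (pull rmax s fz r (clamp 0 1 y))
      by (unfold pull; now rewrite Hyy).
    assert (E := W _ Hy). rewrite Hyy in E. exact E.
Qed.

(** * Energy estimates *)

(** The indices count derivatives in the original variables (r, z), hence the chain-rule factors [s]
    and [s1 * y]. The y-relation includes r = 0 and r = rmax, and the r-relation includes y = 0 and
    y = 1. *)
Record pulled_jet (rmax : R) (s s1 : R -> R) (X : nat -> nat -> R -> R -> R) : Prop := {
  pj_cont : forall i j, cont2 (X i j);
  pj_y : forall i j r y, 0 <= r <= rmax -> 0 < y < 1 ->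
    is_derive (fun y => X i j r y) y (s r * X i (S j) r y);
  pj_r : forall i j r y, 0 < r < rmax ->
    is_derive (fun r => X i j r y) r (X (S i) j r y + s1 r * clamp 0 1 y * X i (S j) r y)
}.

(* The equation [gamma w + alpha^2 w_zz = (k1 + i k2) v], [w = v_r - (m + i n) v],
   in the coordinates [(r, y)]; [X i j + i Y i j] is the derivative of [v] of
   order [i] in [r] and [j] in [z = s(r) y]. *)
Definition w_re (m n : R) (X Y : nat -> nat -> R -> R -> R) (j : nat) (r y : R) : R :=
  X 1%nat j r y - (m * X 0%nat j r y - n * Y 0%nat j r y).

Definition w_im (m n : R) (X Y : nat -> nat -> R -> R -> R) (j : nat) (r y : R) : R :=
  Y 1%nat j r y - (m * Y 0%nat j r y + n * X 0%nat j r y).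

Record pulled_solution (rmax : R) (s s1 : R -> R) (alpha m n k1 k2 : R)
    (g1 g2 : R -> R -> R) (X Y : nat -> nat -> R -> R -> R) : Prop := {
  ps_X : pulled_jet rmax s s1 X;
  ps_Y : pulled_jet rmax s s1 Y;
  ps_0 : forall r, X 0%nat 0%nat r 0 = 0 /\ Y 0%nat 0%nat r 0 = 0;
  ps_1 : forall r, X 0%nat 0%nat r 1 = 0 /\ Y 0%nat 0%nat r 1 = 0;
  ps_r1 : forall r, X 1%nat 0%nat r 1 = 0 /\ Y 1%nat 0%nat r 1 = 0;
  ps_re : forall r y, g1 r y * w_re m n X Y 0 r y - g2 r y * w_im m n X Y 0 r y
    + alpha ^ 2 * w_re m n X Y 2 r y = k1 * X 0%nat 0%nat r y - k2 * Y 0%nat 0%nat r y;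
  ps_im : forall r y, g1 r y * w_im m n X Y 0 r y + g2 r y * w_re m n X Y 0 r y
    + alpha ^ 2 * w_im m n X Y 2 r y = k1 * Y 0%nat 0%nat r y + k2 * X 0%nat 0%nat r y
}.

Lemma pulled_jet_const_l (rmax : R) (s s1 : R -> R) (X : nat -> nat -> R -> R -> R)
    (i j : nat) (y c : R) :
  pulled_jet rmax s s1 X -> (forall r, 0 < r < rmax -> X i j r y = c) ->
  forall r, 0 < r < rmax -> X (S i) j r y + s1 r * clamp 0 1 y * X i (S j) r y = 0.
Proof.
  intros HX Hc r Hr.
  assert (D := pj_r _ _ _ _ HX i j r y Hr).
  apply is_derive_unique in D. rewrite <- D.
  apply is_derive_unique, is_derive_ext_loc with (fun _ => c).
  - apply (locally_open 0 rmax); trivial. intros t Ht. now rewrite Hc.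
  - apply is_derive_constR.
Qed.

Lemma clamp01_0 : clamp 0 1 0 = 0.
Proof. apply clamp_id. lra. Qed.

Lemma clamp01_1 : clamp 0 1 1 = 1.
Proof. apply clamp_id. lra. Qed.

(* Differentiating [v = 0] and [v_r = 0] along the free boundary gives
   [v_z = 0] and [v_rz + s' v_zz = 0] there. *)
Lemma pulled_jet_boundary (rmax : R) (s s1 : R -> R) (X : nat -> nat -> R -> R -> R) :
  pulled_jet rmax s s1 X -> (forall r, 0 < s1 r) ->
  (forall r, X 0%nat 0%nat r 0 = 0) -> (forall r, X 0%nat 0%nat r 1 = 0) ->
  (forall r, X 1%nat 0%nat r 1 = 0) ->
  forall r, 0 < r < rmax ->
    X 1%nat 0%nat r 0 = 0 /\ X 0%nat 1%nat r 1 = 0 /\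
    X 1%nat 1%nat r 1 = - s1 r * X 0%nat 2%nat r 1.
Proof.
  intros HX Hs1 H0 H1 Hr1.
  assert (Hz : forall r, 0 < r < rmax -> X 0%nat 1%nat r 1 = 0).
  { intros r Hr.
    assert (D := pulled_jet_const_l _ _ _ _ 0 0 1 0 HX ltac:(intros; apply H1) r Hr).
    rewrite clamp01_1, Hr1, Rmult_1_r, Rplus_0_l in D. specialize (Hs1 r).
    apply Rmult_integral in D. destruct D; lra. }
  intros r Hr. repeat split.
  - assert (D := pulled_jet_const_l _ _ _ _ 0 0 0 0 HX ltac:(intros; apply H0) r Hr).
    rewrite clamp01_0 in D. lra.
  - now apply Hz.
  - assert (D := pulled_jet_const_l _ _ _ _ 0 1 1 0 HX Hz r Hr).
    rewrite clamp01_1 in D. lra.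
Qed.

Lemma pulled_dirichlet (rmax : R) (s s1 : R -> R) (alpha m n k1 k2 : R)
    (g1 g2 : R -> R -> R) (X Y : nat -> nat -> R -> R -> R) (r : R) :
  pulled_solution rmax s s1 alpha m n k1 k2 g1 g2 X Y ->
  0 < alpha -> 0 < s r -> (forall r, 0 < s1 r) -> cont2 g1 -> cont2 g2 -> 0 < r < rmax ->
  dirichlet (s r) alpha (g1 r) (g2 r)
    (fun y => k1 * X 0%nat 0%nat r y - k2 * Y 0%nat 0%nat r y)
    (fun y => k1 * Y 0%nat 0%nat r y + k2 * X 0%nat 0%nat r y)
    (w_re m n X Y 0 r) (w_re m n X Y 1 r) (w_re m n X Y 2 r)
    (w_im m n X Y 0 r) (w_im m n X Y 1 r) (w_im m n X Y 2 r).
Proof.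
  intros [HX HY H0 H1 Hr1 Hre Him] Hal Hs Hs1 Hg1 Hg2 Hr.
  assert (CX := pj_cont _ _ _ _ HX). assert (CY := pj_cont _ _ _ _ HY).
  assert (BX := pulled_jet_boundary _ _ _ _ HX Hs1 (fun r => proj1 (H0 r)) (fun r => proj1 (H1 r))
    (fun r => proj1 (Hr1 r)) r Hr).
  assert (BY := pulled_jet_boundary _ _ _ _ HY Hs1 (fun r => proj2 (H0 r)) (fun r => proj2 (H1 r))
    (fun r => proj2 (Hr1 r)) r Hr).
  assert (Cw : forall j, cont1 (w_re m n X Y j r)) by (intros j; unfold w_re; cont).
  assert (Cw' : forall j, cont1 (w_im m n X Y j r)) by (intros j; unfold w_im; cont).
  assert (DX := fun i j y => pj_y _ _ _ _ HX i j r y ltac:(lra)).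
  assert (DY := fun i j y => pj_y _ _ _ _ HY i j r y ltac:(lra)).
  assert (Dw : forall j y, 0 < y < 1 ->
    is_derive (w_re m n X Y j r) y (s r * w_re m n X Y (S j) r y)).
  { intros j y Hy. unfold w_re. evar_last.
    - apply is_derive_minusR; [now apply DX|].
      apply is_derive_minusR; apply is_derive_scalR; [now apply DX | now apply DY].
    - simpl. ring. }
  assert (Dw' : forall j y, 0 < y < 1 ->
    is_derive (w_im m n X Y j r) y (s r * w_im m n X Y (S j) r y)).
  { intros j y Hy. unfold w_im. evar_last.
    - apply is_derive_minusR; [now apply DY|].
      apply is_derive_plusR; apply is_derive_scalR; [now apply DY | now apply DX].
    - simpl. ring. }
  refine (Build_dirichlet _ _ _ _ _ _ _ _ _ _ _ _ Hs Hal _ _ _ _ (Cw _) (Cw _) (Cw _)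
    (Cw' _) (Cw' _) (Cw' _) (Dw _) (Dw _) (Dw' _) (Dw' _) _
    (fun y _ => Hre r y) (fun y _ => Him r y)); try cont.
  (* Dirichlet values: v and v_r vanish at both ends, and w is a combination of them. *)
  unfold w_re, w_im. destruct (H0 r) as [-> ->], (H1 r) as [-> ->], (Hr1 r) as [-> ->].
  destruct BX as [-> _], BY as [-> _]. repeat split; ring.
Qed.

(** The coercivity constant [C0] is the only input that depends on the case of the theorem. [C] is
    fixed before the slice, so the bounds are uniform in r. *)
Lemma dirichlet_bounds (alpha G C0 smax : R) :
  0 < alpha -> 0 <= G -> 0 <= C0 -> 0 <= smax ->
  exists C, 0 <= C /\ forall s g1 g2 k l a a1 a2 b b1 b2,
    dirichlet s alpha g1 g2 k l a a1 a2 b b1 b2 -> s <= smax ->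
    (forall y, 0 < y < 1 -> g1 y ^ 2 + g2 y ^ 2 <= G ^ 2) ->
    sqint a b <= C0 * sqint k l ->
    sqint a b <= C * sqint k l /\ sqint a1 b1 <= C * sqint k l /\
    sqint a2 b2 <= C * sqint k l /\ a1 1 ^ 2 + b1 1 ^ 2 <= C * sqint k l.
Proof.
  intros Hal HG HC0 Hsm.
  assert (Ha2 : 0 < alpha ^ 2) by now apply pow_lt.
  assert (Ha4 : 0 < alpha ^ 4) by now apply pow_lt.
  set (C1 := / alpha ^ 2 * ((G + / 2) * C0 + / 2)).
  set (C2 := / alpha ^ 4 * (2 * G ^ 2 * C0 + 2)).
  assert (HG2 := pow2_ge_0 G).
  assert (HC1 : 0 <= C1) by (apply Rmult_le_pos; [apply Rlt_le, Rinv_0_lt_compat, Ha2 | nra]).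
  assert (HC2 : 0 <= C2) by (apply Rmult_le_pos; [apply Rlt_le, Rinv_0_lt_compat, Ha4 | nra]).
  (* The factors [1 + smax] make this single constant cover the trace as well. *)
  exists (C0 + (1 + smax) * C1 + (1 + smax) * C2). split; [nra|].
  intros s g1 g2 k l a a1 a2 b b1 b2 D Hs Hg HW.
  assert (P := gradient_le _ _ _ _ _ _ _ _ _ _ _ _ G D HG Hg).
  assert (Q := second_derivative_le _ _ _ _ _ _ _ _ _ _ _ _ G D Hg).
  destruct D as [Hs0 _ Hg1 Hg2 Hk Hl Ha Ha1 Ha2' Hb Hb1 Hb2 _ Da1 _ Db1 _ _ _].
  assert (T := trace_le s a1 a2 b1 b2 Hs0 Ha1 Ha2' Hb1 Hb2 Da1 Db1).
  assert (H := sqint_pos k l Hk Hl).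
  assert (H1 := sqint_pos a1 b1 Ha1 Hb1). assert (H2 := sqint_pos a2 b2 Ha2' Hb2).
  assert (W1 : sqint a1 b1 <= C1 * sqint k l).
  { apply Rmult_le_reg_l with (alpha ^ 2); trivial. eapply Rle_trans; [exact P|].
    unfold C1. rewrite <- !Rmult_assoc, Rinv_r, Rmult_1_l by lra.
    assert ((G + / 2) * sqint a b <= (G + / 2) * (C0 * sqint k l)) by (apply Rmult_le_compat_l; lra).
    lra. }
  assert (W2 : sqint a2 b2 <= C2 * sqint k l).
  { apply Rmult_le_reg_l with (alpha ^ 4); trivial. eapply Rle_trans; [exact Q|].
    unfold C2. rewrite <- !Rmult_assoc, Rinv_r, Rmult_1_l by lra.
    assert (2 * G ^ 2 * sqint a b <= 2 * G ^ 2 * (C0 * sqint k l)) by (apply Rmult_le_compat_l; lra).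
    lra. }
  clearbody C1 C2.
  assert (Z0 : 0 <= C0 * sqint k l) by (now apply Rmult_le_pos).
  assert (Z1 : 0 <= smax * (C1 * sqint k l)) by (repeat apply Rmult_le_pos; trivial).
  assert (Z2 : 0 <= smax * (C2 * sqint k l)) by (repeat apply Rmult_le_pos; trivial).
  assert (Y1 : s * sqint a1 b1 <= smax * (C1 * sqint k l)) by (apply Rmult_le_compat; lra).
  assert (Y2 : s * sqint a2 b2 <= smax * (C2 * sqint k l)) by (apply Rmult_le_compat; lra).
  repeat split; lra.
Qed.

(** The squared L^2 norm of the j-th z-derivative of v on [0, s(r)]; the factor [s r] is the
    Jacobian of z = s(r) y. *)
Definition energy (s : R -> R) (X Y : nat -> nat -> R -> R -> R) (j : nat) (r : R) : R :=
  s r * sqint (X 0%nat j r) (Y 0%nat j r).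

Lemma cont1_energy (s : R -> R) (X Y : nat -> nat -> R -> R -> R) (j : nat) :
  cont1 s -> (forall i j, cont2 (X i j)) -> (forall i j, cont2 (Y i j)) ->
  cont1 (energy s X Y j).
Proof. intros Hs HX HY. unfold energy, sqint. cont. Qed.

Lemma is_derive_energy_jet (rmax : R) (s s1 : R -> R) (X Y : nat -> nat -> R -> R -> R) (j : nat) :
  cont1 s -> cont1 s1 -> (forall r, 0 < r < rmax -> is_derive s r (s1 r)) ->
  pulled_jet rmax s s1 X -> pulled_jet rmax s s1 Y ->
  forall r, 0 < r < rmax ->
    is_derive (energy s X Y j) r
      (s1 r * (X 0%nat j r 1 ^ 2 + Y 0%nat j r 1 ^ 2)
       + s r * RInt (fun y => 2 * X 0%nat j r y * X 1%nat j r y + 2 * Y 0%nat j r y * Y 1%nat j r y) 0 1).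
Proof.
  intros Hs Hs1 Hd HX HY r Hr.
  assert (CX := pj_cont _ _ _ _ HX). assert (CY := pj_cont _ _ _ _ HY).
  apply is_derive_ext with (fun r => s r * RInt (fun y => X 0%nat j r y ^ 2) 0 1
    + s r * RInt (fun y => Y 0%nat j r y ^ 2) 0 1).
  { intros t. unfold energy, sqint. rewrite RInt_plus_cont by cont. symmetry. apply Rmult_plus_distr_l. }
  assert (D : forall Z, pulled_jet rmax s s1 Z ->
    is_derive (fun r => s r * RInt (fun y => Z 0%nat j r y ^ 2) 0 1) r
      (s1 r * Z 0%nat j r 1 ^ 2 + s r * RInt (fun y => 2 * Z 0%nat j r y * Z 1%nat j r y) 0 1)).
  { intros Z HZ. assert (CZ := pj_cont _ _ _ _ HZ).
    apply (is_derive_energy s s1 (Z 0%nat j) (Z 1%nat j) (Z 0%nat (S j)) rmax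
      (CZ _ _) (CZ _ _) (CZ _ _) Hs1 Hs Hd); trivial.
    - intros t y Ht Hy. apply (pj_y _ _ _ _ HZ); lra.
    - intros t y Ht. now apply (pj_r _ _ _ _ HZ). }
  rewrite RInt_plus_cont by cont. evar_last.
  - apply is_derive_plusR; [exact (D X HX) | exact (D Y HY)].
  - ring.
Qed.

(** Substitution of v_r = mu v + w: in twice the real part of v_r times the conjugate of v, the
    imaginary part [n] of mu cancels, and the w-term is split by Young's inequality. *)
Lemma cross_term_le (m n : R) (X Y : nat -> nat -> R -> R -> R) (j : nat) (r : R) :
  (forall i j, cont2 (X i j)) -> (forall i j, cont2 (Y i j)) ->
  RInt (fun y => 2 * X 0%nat j r y * X 1%nat j r y + 2 * Y 0%nat j r y * Y 1%nat j r y) 0 1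
  <= sqint (w_re m n X Y j r) (w_im m n X Y j r)
     + (1 + 2 * Rabs m) * sqint (X 0%nat j r) (Y 0%nat j r).
Proof.
  intros HX HY.
  assert (Cw : cont1 (w_re m n X Y j r)) by (unfold w_re; cont).
  assert (Cw' : cont1 (w_im m n X Y j r)) by (unfold w_im; cont).
  rewrite <- (Rmult_1_l (sqint (w_re m n X Y j r) _)), <- RInt_sqint2 by cont.
  apply RInt_le_cont; [lra | cont | cont |]. intros y _.
  unfold w_re, w_im. set (x0 := X 0%nat j r y). set (y0 := Y 0%nat j r y).
  set (x1 := X 1%nat j r y). set (y1 := Y 1%nat j r y).
  assert (Q := sum_sqr_ge_0 (x1 - (m * x0 - n * y0) - x0) (y1 - (m * y0 + n * x0) - y0)).
  assert (P : 0 <= (Rabs m - m) * (x0 ^ 2 + y0 ^ 2)).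
  { apply Rmult_le_pos; [assert (H := Rle_abs m); lra | apply sum_sqr_ge_0]. }
  nra.
Qed.

(** The datum is h = kappa v with [k1 ^ 2 + k2 ^ 2 = |kappa|^2], so every w-term is a multiple of
    the energy of order 0. That energy is paid once per summand, at most 3 times. The inverse of
    [s1min * smin] comes from the trace of v_zz. *)
Lemma energy_stable (rmax : R) (s s1 : R -> R) (alpha m n k1 k2 C smin s1min : R)
    (X Y : nat -> nat -> R -> R -> R) (g1 g2 : R -> R -> R) (l : nat) :
  0 <= C -> cont1 s -> cont1 s1 ->
  (forall r, 0 < r < rmax -> is_derive s r (s1 r)) ->
  0 < smin -> 0 < s1min -> (forall r, smin <= s r) -> (forall r, s1min <= s1 r) ->
  pulled_solution rmax s s1 alpha m n k1 k2 g1 g2 X Y ->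
  (forall r, 0 < r < rmax ->
    let H := sqint (fun y => k1 * X 0%nat 0%nat r y - k2 * Y 0%nat 0%nat r y)
      (fun y => k1 * Y 0%nat 0%nat r y + k2 * X 0%nat 0%nat r y) in
    (forall j, (j <= 2)%nat -> sqint (w_re m n X Y j r) (w_im m n X Y j r) <= C * H) /\
    w_re m n X Y 1 r 1 ^ 2 + w_im m n X Y 1 r 1 ^ 2 <= C * H) ->
  (l <= 2)%nat ->
  forall r, 0 <= r <= rmax ->
    sum_f_R0 (fun j => energy s X Y j r) l
    <= exp ((3 * (C * (k1 ^ 2 + k2 ^ 2) * (1 + / (s1min * smin))) + (1 + 2 * Rabs m)) * r)
       * sum_f_R0 (fun j => energy s X Y j 0) l.
Proof.
  intros HC Hs Hs1 Hd Hsm Hs1m Hsb Hs1b [HX HY H0 H1 Hr1 _ _] HE Hl.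
  assert (CX := pj_cont _ _ _ _ HX). assert (CY := pj_cont _ _ _ _ HY).
  assert (Hs1p : forall r, 0 < s1 r) by (intros r; specialize (Hs1b r); lra).
  set (kk := k1 ^ 2 + k2 ^ 2). assert (Hkk : 0 <= kk) by apply sum_sqr_ge_0.
  set (K1 := C * kk * (1 + / (s1min * smin))). set (K2 := 1 + 2 * Rabs m).
  assert (Hinv : 0 < / (s1min * smin)) by (apply Rinv_0_lt_compat, Rmult_lt_0_compat; trivial).
  assert (HCk : 0 <= C * kk) by now apply Rmult_le_pos.
  assert (HK1 : 0 <= K1) by (apply Rmult_le_pos; lra).
  set (dE j r := s1 r * (X 0%nat j r 1 ^ 2 + Y 0%nat j r 1 ^ 2)
       + s r * RInt (fun y => 2 * X 0%nat j r y * X 1%nat j r y + 2 * Y 0%nat j r y * Y 1%nat j r y) 0 1).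
  assert (HdE : forall j r, 0 < r < rmax -> is_derive (energy s X Y j) r (dE j r))
    by (intros; now apply (is_derive_energy_jet rmax)).
  assert (Epos : forall j r, 0 <= energy s X Y j r).
  { intros j r. apply Rmult_le_pos; [specialize (Hsb r); lra | apply sqint_pos; cont]. }
  assert (Hbound : forall j r, (j <= 2)%nat -> 0 < r < rmax ->
    dE j r <= K1 * energy s X Y 0 r + K2 * energy s X Y j r).
  { intros j r Hj Hr. specialize (HE r Hr). cbv zeta in HE.
    assert (EH : sqint (fun y => k1 * X 0%nat 0%nat r y - k2 * Y 0%nat 0%nat r y)
      (fun y => k1 * Y 0%nat 0%nat r y + k2 * X 0%nat 0%nat r y)
      = kk * sqint (X 0%nat 0%nat r) (Y 0%nat 0%nat r)).
    { unfold sqint. rewrite <- RInt_scal_cont by cont. apply RInt_ext_01.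
      intros y _. unfold kk. ring. }
    rewrite EH in HE. destruct HE as [HEj HET]. specialize (HEj j Hj).
    assert (Hsr := Hsb r). assert (Hs1r := Hs1b r).
    assert (Hc := cross_term_le m n X Y j r CX CY). fold K2 in Hc.
    assert (Int : s r * RInt (fun y => 2 * X 0%nat j r y * X 1%nat j r y
        + 2 * Y 0%nat j r y * Y 1%nat j r y) 0 1
      <= C * kk * energy s X Y 0 r + K2 * energy s X Y j r).
    { unfold energy.
      replace (C * kk * (s r * sqint (X 0%nat 0%nat r) (Y 0%nat 0%nat r))
        + K2 * (s r * sqint (X 0%nat j r) (Y 0%nat j r)))
        with (s r * (C * (kk * sqint (X 0%nat 0%nat r) (Y 0%nat 0%nat r))
          + K2 * sqint (X 0%nat j r) (Y 0%nat j r))) by ring.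
      apply Rmult_le_compat_l; lra. }
    assert (Bd : s1 r * (X 0%nat j r 1 ^ 2 + Y 0%nat j r 1 ^ 2)
      <= C * kk * / (s1min * smin) * energy s X Y 0 r).
    { assert (BX := pulled_jet_boundary _ _ _ _ HX Hs1p (fun r => proj1 (H0 r))
        (fun r => proj1 (H1 r)) (fun r => proj1 (Hr1 r)) r Hr).
      assert (BY := pulled_jet_boundary _ _ _ _ HY Hs1p (fun r => proj2 (H0 r))
        (fun r => proj2 (H1 r)) (fun r => proj2 (Hr1 r)) r Hr).
      destruct BX as (_ & BX1 & BX2), BY as (_ & BY1 & BY2).
      assert (RHS : 0 <= C * kk * / (s1min * smin) * energy s X Y 0 r)
        by (apply Rmult_le_pos; [apply Rmult_le_pos; [exact HCk | lra] | apply Epos]).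
      destruct j as [|[|[|j]]]; [| | |lia].
      - destruct (H1 r) as [-> ->]. lra.
      - rewrite BX1, BY1. lra.
      (* As v_z = 0 at the free boundary, w_z reduces there to v_rz = - s' v_zz. The bound on
         |w_z|^2 thus controls s'^2 |v_zz|^2; one division by s' gives the boundary term, and one by
         s turns the integral over y into an energy. *)
      - unfold w_re, w_im in HET. rewrite BX1, BY1, BX2, BY2 in HET.
        set (T := X 0%nat 2%nat r 1 ^ 2 + Y 0%nat 2%nat r 1 ^ 2).
        assert (HT : s1 r ^ 2 * T <= C * (kk * sqint (X 0%nat 0%nat r) (Y 0%nat 0%nat r)))
          by (eapply Rle_trans; [|exact HET]; right; unfold T; ring).
        assert (HT0 : 0 <= T) by apply sum_sqr_ge_0.
        apply Rmult_le_reg_l with (s1min * smin); [now apply Rmult_lt_0_compat|].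
        unfold energy.
        replace (s1min * smin * (C * kk * / (s1min * smin) * (s r * sqint (X 0%nat 0%nat r) (Y 0%nat 0%nat r))))
          with (s r * (C * (kk * sqint (X 0%nat 0%nat r) (Y 0%nat 0%nat r)))) by (field; lra).
        apply Rle_trans with (s r * (s1 r ^ 2 * T)); [|apply Rmult_le_compat_l; lra].
        replace (s1min * smin * (s1 r * T)) with (smin * (s1min * s1 r * T)) by ring.
        apply Rmult_le_compat; try lra.
        + repeat apply Rmult_le_pos; lra.
        + apply Rmult_le_compat_r; nra. }
    unfold dE, K1. lra. }
  clear HE.
  assert (Npos : forall r, energy s X Y 0 r <= sum_f_R0 (fun j => energy s X Y j r) l).
  { intros r. clear Hl. induction l as [|l IH]; simpl; [lra|]. specialize (Epos (S l) r). lra. }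
  apply (gronwall (fun r => sum_f_R0 (fun j => energy s X Y j r) l)
    (fun r => sum_f_R0 (fun j => dE j r) l)).
  - intros r. clear Hl Npos. induction l as [|l IH]; simpl.
    + now apply cont1_energy.
    + apply (continuous_plus (fun r => sum_f_R0 (fun j => energy s X Y j r) l)); trivial.
      now apply cont1_energy.
  - intros r Hr. split.
    + clear Hl Npos. induction l as [|l IH]; simpl; [now apply HdE|].
      apply (is_derive_plusR (fun r => sum_f_R0 (fun j => energy s X Y j r) l)); trivial.
      now apply HdE.
    + assert (L : forall l', (l' <= 2)%nat -> sum_f_R0 (fun j => dE j r) l'
        <= INR (S l') * (K1 * energy s X Y 0 r) + K2 * sum_f_R0 (fun j => energy s X Y j r) l').
      { intros l'. induction l' as [|l' IH]; intros Hl'.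
        - simpl. specialize (Hbound 0%nat r Hl' Hr). lra.
        - specialize (IH ltac:(lia)). specialize (Hbound (S l') r Hl' Hr).
          rewrite S_INR. cbn [sum_f_R0] in *. lra. }
      eapply Rle_trans; [now apply L|].
      assert (INR (S l) <= 3) by (replace 3 with (INR 3) by (simpl; ring); apply le_INR; lia).
      assert (0 <= INR (S l)) by apply pos_INR.
      assert (Z : INR (S l) * (K1 * energy s X Y 0 r)
        <= 3 * (K1 * sum_f_R0 (fun j => energy s X Y j r) l)).
      { apply Rmult_le_compat; trivial.
        - apply Rmult_le_pos; trivial.
        - apply Rmult_le_compat_l; trivial. }
      lra.
Qed.

(** * Uniform bounds and the norms *)

(** Compactness of the rectangle. The local number [e] is both the radius of a neighbourhood and a
    lower bound for [f] on it, so a lower bound for the gauge is a lower bound for [f]. *)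
Lemma cont2_pos_lower_bound (f : R -> R -> R) (a b c d : R) :
  cont2 f -> (forall x y, a <= x <= b -> c <= y <= d -> 0 < f x y) ->
  exists m, 0 < m /\ forall x y, a <= x <= b -> c <= y <= d -> m <= f x y.
Proof.
  intros Hf Hp.
  assert (H : forall u v, exists e : posreal, a <= u <= b -> c <= v <= d ->
    forall x y, Rabs (x - u) < e -> Rabs (y - v) < e -> e <= f x y).
  { intros u v.
    destruct (classic (a <= u <= b /\ c <= v <= d)) as [[Hu Hv]|N];
      [|exists (mkposreal 1 Rlt_0_1); tauto].
    assert (P := Hp u v Hu Hv). assert (P2 : 0 < f u v / 2) by lra.
    destruct (Hf u v (mkposreal _ P2)) as [e He]; simpl in He.
    assert (Q : 0 < Rmin e (f u v / 2)) by (apply Rmin_pos; [apply cond_pos | lra]).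
    exists (mkposreal _ Q). simpl. intros _ _ x y Hx Hy.
    assert (M1 := Rmin_l e (f u v / 2)). assert (M2 := Rmin_r e (f u v / 2)).
    specialize (He x y ltac:(lra) ltac:(lra)). apply Rabs_def2 in He. lra. }
  destruct (compactness_value_2d a b c d
    (fun u v => proj1_sig (constructive_indefinite_description _ (H u v)))) as [m Hm].
  exists m. split; [apply cond_pos|]. intros x y Hx Hy.
  apply NNPP. intros N. apply (Hm x y Hx Hy). intros (u & v & Hu & Hv & H1 & H2 & H3).
  apply N. revert H1 H2 H3. destruct constructive_indefinite_description as [e He]. simpl.
  intros H1 H2 H3. apply Rle_trans with e; trivial. now apply He.
Qed.

Lemma extend_lower_bound (rmax : R) (s : R -> R) :
  0 < rmax -> cont1 (extend rmax s) -> (forall r, 0 <= r <= rmax -> 0 < s r) ->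
  exists m, 0 < m /\ forall r, m <= extend rmax s r.
Proof.
  intros Hr Hc Hs.
  destruct (cont2_pos_lower_bound (fun r _ => extend rmax s r) 0 rmax 0 1) as (m & Hm & H).
  - now apply cont2_fst.
  - intros x y Hx _. rewrite extend_id; auto.
  - exists m. split; trivial. intros r.
    assert (Hcl := clamp_bounds 0 rmax r ltac:(lra)).
    specialize (H (clamp 0 rmax r) 0 Hcl ltac:(lra)). now rewrite extend_id in H.
Qed.

Lemma extend_upper_bound (rmax : R) (s : R -> R) :
  0 < rmax -> cont1 (extend rmax s) -> exists m, forall r, extend rmax s r <= m.
Proof.
  intros Hr Hc.
  destruct (continuity_ab_maj (extend rmax s) 0 rmax) as (x & H & _); [lra | |].
  - intros c _. apply continuity_pt_filterlim, Hc.
  - exists (extend rmax s x). intros r.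
    assert (Hcl := clamp_bounds 0 rmax r ltac:(lra)).
    specialize (H _ Hcl). now rewrite extend_id in H.
Qed.

Lemma hnorm_sqr (a : R) (f : R -> C) (l : nat) :
  hnorm a l f = sqrt (sum_f_R0 (fun j => l2norm a (CDerive_n f j) ^ 2) l).
Proof.
  assert (P : forall l, 0 <= sum_f_R0 (fun j => l2norm a (CDerive_n f j) ^ 2) l)
    by (intros k; apply cond_pos_sum; intros; apply pow2_ge_0).
  induction l as [|l IH].
  - simpl. replace (l2norm a (CDerive_n f 0)) with (l2norm a f) by reflexivity.
    rewrite Rmult_1_r, sqrt_square; [reflexivity | apply sqrt_pos].
  - cbn [hnorm sum_f_R0]. rewrite IH, pow2_sqrt by apply P. reflexivity.
Qed.

(** [f] is arbitrary off (0, a), so the induction carries equality on the open interval, which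
    determines the derivatives there. *)
Lemma Derive_n_dilate (f : R -> R) (g : nat -> R -> R) (a : R) :
  0 < a -> (forall z, 0 < z < a -> f z = g 0%nat (z / a)) ->
  (forall j y, 0 < y < 1 -> is_derive (g j) y (a * g (S j) y)) ->
  forall j z, 0 < z < a -> Derive_n f j z = g j (z / a).
Proof.
  intros Ha H0 Hg j. induction j as [|j IH]; intros z Hz; simpl; [now apply H0|].
  apply is_derive_unique, is_derive_ext_loc with (fun z => g j (z / a)).
  - apply (locally_open 0 a); trivial. intros t Ht. symmetry. now apply IH.
  - evar_last.
    + apply (is_derive_comp (g j) (fun z => z / a)).
      * apply Hg. split; [apply Rdiv_lt_0_compat; lra|].
        apply Rmult_lt_reg_r with a; trivial. unfold Rdiv. rewrite Rmult_assoc, Rinv_l; lra.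
      * apply is_derive_multR; [apply is_derive_idR | apply is_derive_constR].
    + unfold scal; simpl; unfold mult; simpl. field. lra.
Qed.

Lemma l2norm_dilate (f : R -> C) (x y : R -> R) (a : R) :
  0 < a -> cont1 x -> cont1 y ->
  (forall z, 0 < z < a -> f z = (x (z / a), y (z / a))) ->
  l2norm a f ^ 2 = a * sqint x y.
Proof.
  intros Ha Hx Hy Hf. unfold l2norm.
  assert (Cd : forall h, cont1 h -> cont1 (fun z => h (z / a))).
  { intros h Hh z. apply (continuous_comp (fun z => z / a) h); [|apply Hh].
    apply (cont1_mult (fun z => z) (fun _ => / a)); cont. }
  assert (Cx := Cd x Hx). assert (Cy := Cd y Hy).
  replace (RInt (fun z => Cmod (f z) ^ 2) 0 a)
    with (RInt (fun z => x (z / a) ^ 2 + y (z / a) ^ 2) 0 a).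
  2:{ apply RInt_ext. rewrite Rmin_left, Rmax_right by lra. intros z Hz.
      rewrite Hf by trivial. unfold Cmod. rewrite pow2_sqrt by apply sum_sqr_ge_0. reflexivity. }
  replace (RInt (fun z => x (z / a) ^ 2 + y (z / a) ^ 2) 0 a) with (a * sqint x y).
  - apply pow2_sqrt. apply Rmult_le_pos; [lra | now apply sqint_pos].
  - transitivity (RInt (fun z => x (z / a) ^ 2 + y (z / a) ^ 2) (a * 0 + 0) (a * 1 + 0)).
    + rewrite <- (RInt_comp_lin (V := R_CompleteNormedModule)
        (fun z => x (z / a) ^ 2 + y (z / a) ^ 2)) by exint.
      unfold sqint. rewrite <- RInt_scal_cont by cont. apply RInt_ext_01. intros z _.
      unfold scal; simpl; unfold mult; simpl. replace ((a * z + 0) / a) with z by (field; lra).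
      reflexivity.
    + f_equal; ring.
Qed.

(** [f] need only agree with the slice in its interior, so that the lemma applies to [v0] as well as
    to [v r]. *)
Lemma hnorm_energy (rmax : R) (s s1 : R -> R) (X Y : nat -> nat -> R -> R -> R) (f : R -> C)
    (r : R) (l : nat) :
  pulled_jet rmax s s1 X -> pulled_jet rmax s s1 Y -> 0 <= r <= rmax -> 0 < s r ->
  (forall z, 0 < z < s r -> f z = (X 0%nat 0%nat r (z / s r), Y 0%nat 0%nat r (z / s r))) ->
  hnorm (s r) l f = sqrt (sum_f_R0 (fun j => energy s X Y j r) l).
Proof.
  intros HX HY Hr Hs Hf. rewrite hnorm_sqr. f_equal. apply sum_eq. intros j _.
  assert (CX := pj_cont _ _ _ _ HX). assert (CY := pj_cont _ _ _ _ HY).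
  apply l2norm_dilate; [trivial | cont | cont |].
  intros z Hz. unfold CDerive_n. f_equal.
  - apply (Derive_n_dilate _ (fun j => X 0%nat j r)); trivial.
    + intros t Ht. now rewrite Hf.
    + intros k y Hy. apply (pj_y _ _ _ _ HX); lra.
  - apply (Derive_n_dilate _ (fun j => Y 0%nat j r)); trivial.
    + intros t Ht. now rewrite Hf.
    + intros k y Hy. apply (pj_y _ _ _ _ HY); lra.
Qed.

(** * From complex jets to pairs of real functions *)

Lemma is_derive_Re (f : R -> C) (x : R) (l : C) :
  is_derive (K := R_AbsRing) (V := C_R_NormedModule) f x l ->
  is_derive (fun t => Re (f t)) x (Re l).
Proof.
  intros H. unfold is_derive in *.
  apply filterdiff_ext_lin with (fun y => fst (scal (V := C_R_NormedModule) y l)); [|reflexivity].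
  apply (filterdiff_comp' (U := R_NormedModule) (V := C_R_NormedModule) (W := R_NormedModule)
    f (fun z => fst z)); [exact H|].
  apply filterdiff_linear. apply (is_linear_fst (U := R_NormedModule) (V := R_NormedModule)).
Qed.

Lemma is_derive_Im (f : R -> C) (x : R) (l : C) :
  is_derive (K := R_AbsRing) (V := C_R_NormedModule) f x l ->
  is_derive (fun t => Im (f t)) x (Im l).
Proof.
  intros H. unfold is_derive in *.
  apply filterdiff_ext_lin with (fun y => snd (scal (V := C_R_NormedModule) y l)); [|reflexivity].
  apply (filterdiff_comp' (U := R_NormedModule) (V := C_R_NormedModule) (W := R_NormedModule)
    f (fun z => snd z)); [exact H|].
  apply filterdiff_linear. apply (is_linear_snd (U := R_NormedModule) (V := R_NormedModule)).
Qed.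

(** [pr] stands for [Re] or [Im]; continuity and compatibility with derivatives are all that is used
    of it. *)
Lemma pulled_jet_proj (rmax : R) (s s1 : R -> R) (v : R -> R -> C)
    (V : nat -> nat -> R -> R -> C) (pr : C -> R) :
  0 < rmax -> (forall r, 0 <= r <= rmax -> 0 < s r) ->
  cont1 (extend rmax s) -> cont1 (extend rmax s1) ->
  (forall r, 0 < r < rmax -> is_derive s r (s1 r)) ->
  smooth_jet2 (dom rmax s) v V ->
  (forall z : C_UniformSpace, continuous (pr : C_UniformSpace -> R_UniformSpace) z) ->
  (forall f x l, is_derive (K := R_AbsRing) (V := C_R_NormedModule) f x l ->
    is_derive (fun t => pr (f t)) x (pr l)) ->
  (forall i j, cont2 (pull rmax s (fun r z => pr (V i j r z)))) /\
  pulled_jet rmax (extend rmax s) (extend rmax s1)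
    (fun i j => pull rmax s (fun r z => pr (V i j r z))).
Proof.
  intros Hrm Hs Hc Hc1 Hd [_ HV Hr Hz] Hpr Hpd.
  assert (HC : forall i j, cont_dom rmax s (fun r z => pr (V i j r z))).
  { intros i j x Hx. eapply filterlim_comp; [apply (HV i j x Hx) | apply Hpr]. }
  assert (HC2 : forall i j, cont2 (pull rmax s (fun r z => pr (V i j r z))))
    by (intros; now apply cont2_pull).
  split; trivial. split; trivial.
  - intros i j. apply is_derive_pull_y; trivial. intros r z H. now apply Hpd, Hz.
  - intros i j. apply is_derive_pull_r; trivial; intros r z H; [now apply Hpd, Hr | now apply Hpd, Hz].
Qed.

Lemma continuous_Re (z : C_UniformSpace) : continuous (Re : C_UniformSpace -> R_UniformSpace) z.
Proof. destruct z as [x y]. apply (continuous_fst (U := R_UniformSpace) (V := R_UniformSpace)). Qed.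

Lemma continuous_Im (z : C_UniformSpace) : continuous (Im : C_UniformSpace -> R_UniformSpace) z.
Proof. destruct z as [x y]. apply (continuous_snd (U := R_UniformSpace) (V := R_UniformSpace)). Qed.

(** After division by q, subtracting mu (gamma v + alpha^2 v_zz) with mu = i lambda / q cancels v_zz
    and beta v; only - (mu / q) v survives. *)
Lemma equation_w (q lam b v vr vzz vrzz : C) (al2 : C) :
  q <> RtoC 0 ->
  ((1 + q * b) * vr + al2 * q * vrzz = Ci * lam * (al2 * vzz + b * v))%C ->
  ((/ q + b) * (vr - Ci * lam / q * v) + al2 * (vrzz - Ci * lam / q * vzz)
   = - (Ci * lam / q / q) * v)%C.
Proof.
  intros Hq H.
  replace ((/ q + b) * (vr - Ci * lam / q * v) + al2 * (vrzz - Ci * lam / q * vzz))%C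
    with (/ q * ((1 + q * b) * vr + al2 * q * vrzz)
          - Ci * lam / q * ((/ q + b) * v + al2 * vzz))%C by (field; trivial).
  rewrite H. field. trivial.
Qed.

Lemma Cmult_re_im (a b c d e : C) (al2 : R) :
  (a * b + RtoC al2 * c = d * e)%C ->
  Re a * Re b - Im a * Im b + al2 * Re c = Re d * Re e - Im d * Im e /\
  Re a * Im b + Im a * Re b + al2 * Im c = Re d * Im e + Im d * Re e.
Proof.
  destruct a as [a1 a2], b as [b1 b2], c as [c1 c2], d as [d1 d2], e as [e1 e2].
  intros H. apply (f_equal (fun z => (Re z, Im z))) in H. simpl in H.
  injection H as H1 H2. simpl. split; lra.
Qed.

Lemma is_solution_pulled (rmax alpha : R) (q lam : C) (s s1 : R -> R) (beta : R -> R -> C)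
    (B V : nat -> nat -> R -> R -> C) (v : R -> R -> C) :
  0 < rmax -> (forall r, 0 <= r <= rmax -> 0 < s r) ->
  cont1 (extend rmax s) -> cont1 (extend rmax s1) ->
  (forall r, 0 < r < rmax -> is_derive s r (s1 r)) ->
  q <> RtoC 0 -> smooth_jet2 (dom rmax s) beta B -> smooth_jet2 (dom rmax s) v V ->
  (forall r z, dom rmax s r z ->
     ((1 + q * beta r z) * V 1%nat 0%nat r z + RtoC (alpha ^ 2)%R * q * V 1%nat 2%nat r z
       = Ci * lam * (RtoC (alpha ^ 2)%R * V 0%nat 2%nat r z + beta r z * v r z))%C) ->
  (forall r, (0 <= r <= rmax)%R ->
       v r 0%R = RtoC 0 /\ v r (s r) = RtoC 0 /\ V 1%nat 0%nat r (s r) = RtoC 0) ->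
  let mu := (Ci * lam / q)%C in let kap := (- (mu / q))%C in
  pulled_solution rmax (extend rmax s) (extend rmax s1) alpha (Re mu) (Im mu) (Re kap) (Im kap)
    (fun r y => Re (/ q)%C + pull rmax s (fun r z => Re (B 0%nat 0%nat r z)) r y)
    (fun r y => Im (/ q)%C + pull rmax s (fun r z => Im (B 0%nat 0%nat r z)) r y)
    (fun i j => pull rmax s (fun r z => Re (V i j r z)))
    (fun i j => pull rmax s (fun r z => Im (V i j r z))).
Proof.
  intros Hrm Hs Hc Hc1 Hd Hq HB HV Heq Hbd mu kap.
  destruct (pulled_jet_proj rmax s s1 v V Re) as [_ HX]; trivial;
    [apply continuous_Re | apply is_derive_Re |].
  destruct (pulled_jet_proj rmax s s1 v V Im) as [_ HY]; trivial;
    [apply continuous_Im | apply is_derive_Im |].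
  assert (Hcl := fun r => clamp_bounds 0 rmax r ltac:(lra)).
  (* The projected point lies in the domain for all real [r] and [y], so the equation holds for the
     extended functions on the whole plane. *)
  assert (E : forall r y,
    ((/ q + B 0%nat 0%nat (clamp 0 rmax r) (extend rmax s r * clamp 0 1 y)%R)
      * (V 1%nat 0%nat (clamp 0 rmax r) (extend rmax s r * clamp 0 1 y)%R
         - mu * V 0%nat 0%nat (clamp 0 rmax r) (extend rmax s r * clamp 0 1 y)%R)
      + RtoC (alpha ^ 2)
      * (V 1%nat 2%nat (clamp 0 rmax r) (extend rmax s r * clamp 0 1 y)%R
         - mu * V 0%nat 2%nat (clamp 0 rmax r) (extend rmax s r * clamp 0 1 y)%R)
      = kap * V 0%nat 0%nat (clamp 0 rmax r) (extend rmax s r * clamp 0 1 y)%R)%C).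
  { intros r y. assert (D := pull_dom rmax s r y Hrm Hs).
    apply equation_w; trivial.
    rewrite (jet2_0 _ _ _ HB), (jet2_0 _ _ _ HV) by trivial. now apply Heq. }
  split; trivial.
  - intros r. unfold pull. rewrite clamp01_0, Rmult_0_r, (jet2_0 _ _ _ HV).
    + destruct (Hbd _ (Hcl r)) as [-> _]. now split.
    + specialize (Hs _ (Hcl r)). split; trivial. lra.
  - intros r. unfold pull. rewrite clamp01_1, Rmult_1_r, (jet2_0 _ _ _ HV).
    + unfold extend. destruct (Hbd _ (Hcl r)) as [_ [-> _]]. now split.
    + specialize (Hs _ (Hcl r)). unfold extend. split; trivial. lra.
  - intros r. unfold pull. rewrite clamp01_1, Rmult_1_r. unfold extend.
    destruct (Hbd _ (Hcl r)) as [_ [_ ->]]. now split.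
  - intros r y. exact (proj1 (Cmult_re_im _ _ _ _ _ _ (E r y))).
  - intros r y. exact (proj2 (Cmult_re_im _ _ _ _ _ _ (E r y))).
Qed.

(** * Choice of the constants and conclusion *)

Theorem theorem2p2 :
  forall (q : C) (M : R), q <> RtoC 0 -> 0 <= M ->
  exists eps0 : R, 0 < eps0 /\
  forall (rmax alpha : R) (p : C) (s : R -> R) (beta : R -> R -> C),
    0 < rmax -> 0 < alpha ->
    (forall r, 0 <= r <= rmax -> 0 < s r) ->
    smooth_increasing rmax s ->
    smooth2 (dom rmax s) beta ->
    (forall r z, dom rmax s r z -> Cmod (beta r z) <= M) ->
    ( (forall r z, dom rmax s r z -> 0 < Im (/ q + beta r z)%C) \/
      (forall r z, dom rmax s r z -> Im (/ q + beta r z)%C < 0) \/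
      (forall r, 0 <= r <= rmax -> / alpha * s r <= eps0) ) ->
    forall l : nat, (l <= 2)%nat ->
    exists K : R,
      forall (v0 : R -> C) (v : R -> R -> C),
        is_solution rmax alpha q ((p - q) / RtoC alpha)%C s beta v0 v ->
        forall r, 0 <= r <= rmax ->
          hnorm (s r) l (v r) <= K * hnorm (s 0) l v0.
Proof.
  (* [G] bounds |gamma| = |1/q + beta| and depends on q and M only; hence so does the threshold
     [eps0], taken from [coercive_small]. *)
  intros q M Hq HM. set (G := Cmod (/ q) + M).
  assert (HG : 0 <= G) by (assert (H := Cmod_ge_0 (/ q)); unfold G; lra).
  exists (/ (4 * (G + 1))). split; [apply Rinv_0_lt_compat; lra|].
  intros rmax alpha p s beta Hrm Hal Hs [S [[HS0 HSc HSd] HS1]] [B HB] HbM Hcase l Hl.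
  assert (Hc : cont1 (extend rmax s)).
  { apply cont1_extend; trivial. apply continuous_on_ext with (S 0%nat); trivial. }
  assert (Hc1 : cont1 (extend rmax (S 1%nat))) by now apply cont1_extend.
  assert (Hd : forall r, 0 < r < rmax -> is_derive s r (S 1%nat r)).
  { intros r Hr. apply is_derive_ext_loc with (S 0%nat).
    - apply (locally_open 0 rmax); trivial. intros t Ht. apply HS0. lra.
    - apply HSd, (locally_open 0 rmax); trivial. intros t Ht. lra. }
  assert (Hde : forall r, 0 < r < rmax -> is_derive (extend rmax s) r (extend rmax (S 1%nat) r)).
  { intros r Hr. rewrite extend_id by lra. apply is_derive_ext_loc with s; [|now apply Hd].
    now apply extend_open. }
  destruct (extend_lower_bound rmax s Hrm Hc Hs) as (smin & Hsm & Hsb).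
  destruct (extend_lower_bound rmax (S 1%nat) Hrm Hc1 HS1) as (s1min & Hs1m & Hs1b).
  destruct (extend_upper_bound rmax s Hrm Hc) as (smax & Hsmax).
  destruct (pulled_jet_proj rmax s (S 1%nat) beta B Re) as [CB1 _]; trivial;
    [apply continuous_Re | apply is_derive_Re |].
  destruct (pulled_jet_proj rmax s (S 1%nat) beta B Im) as [CB2 _]; trivial;
    [apply continuous_Im | apply is_derive_Im |].
  set (g1 r y := Re (/ q)%C + pull rmax s (fun r z => Re (B 0%nat 0%nat r z)) r y).
  set (g2 r y := Im (/ q)%C + pull rmax s (fun r z => Im (B 0%nat 0%nat r z)) r y).
  assert (Cg1 : cont2 g1) by (unfold g1; apply cont2_plus; [apply cont2_const | apply CB1]).
  assert (Cg2 : cont2 g2) by (unfold g2; apply cont2_plus; [apply cont2_const | apply CB2]).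
  (* Every value of the extended coefficient is a value of gamma in the domain, so size and sign
     conditions carry over. *)
  assert (Hg : forall r y, exists r' z, dom rmax s r' z /\
    g1 r y = Re (/ q + beta r' z)%C /\ g2 r y = Im (/ q + beta r' z)%C).
  { intros r y. exists (clamp 0 rmax r), (extend rmax s r * clamp 0 1 y).
    assert (D := pull_dom rmax s r y Hrm Hs). split; trivial.
    rewrite <- (jet2_0 _ _ _ HB) by trivial. now split. }
  assert (HgG : forall r y, g1 r y ^ 2 + g2 r y ^ 2 <= G ^ 2).
  { intros r y. destruct (Hg r y) as (r' & z & D & -> & ->).
    replace (Re (/ q + beta r' z)%C ^ 2 + Im (/ q + beta r' z)%C ^ 2)
      with (Cmod (/ q + beta r' z) ^ 2) by (unfold Cmod; now rewrite pow2_sqrt by apply sum_sqr_ge_0).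
    apply pow_incr. split; [apply Cmod_ge_0|].
    eapply Rle_trans; [apply Cmod_triangle|]. apply Rplus_le_compat_l. now apply HbM. }
  set (mu := (Ci * ((p - q) / RtoC alpha) / q)%C). set (kap := (- (mu / q))%C).
  assert (HC0 : exists C0, 0 <= C0 /\ forall r k l a a1 a2 b b1 b2, 0 < r < rmax ->
    dirichlet (extend rmax s r) alpha (g1 r) (g2 r) k l a a1 a2 b b1 b2 ->
    sqint a b <= C0 * sqint k l).
  { assert (Hsign : forall e, e ^ 2 = 1 ->
      (forall r z, dom rmax s r z -> 0 < e * Im (/ q + beta r z)%C) ->
      exists C0, 0 <= C0 /\ forall r k l a a1 a2 b b1 b2, 0 < r < rmax ->
      dirichlet (extend rmax s r) alpha (g1 r) (g2 r) k l a a1 a2 b b1 b2 ->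
      sqint a b <= C0 * sqint k l).
    { intros e He Hpos.
      (* Compactness turns the pointwise sign of Im gamma into a uniform gap [c]. *)
      destruct (cont2_pos_lower_bound (fun r y => e * g2 r y) 0 rmax 0 1) as (c & Hc0 & Hcg).
      - cont.
      - intros r y _ _. destruct (Hg r y) as (r' & z & D & _ & ->). now apply Hpos.
      - exists (/ c ^ 2). split; [apply Rlt_le, Rinv_0_lt_compat, pow_lt, Hc0|].
        intros r k l' a a1 a2 b b1 b2 Hr D.
        apply (coercive_im _ _ _ _ _ _ _ _ _ _ _ _ e c D); trivial.
        intros y Hy. apply Hcg; lra. }
    destruct Hcase as [H|[H|H]].
    - apply (Hsign 1); [ring|]. intros r z D. rewrite Rmult_1_l. now apply H.
    - apply (Hsign (-1)); [ring|]. intros r z D. specialize (H r z D). lra.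
    - exists 1. split; [lra|]. intros r k l' a a1 a2 b b1 b2 Hr D. rewrite Rmult_1_l.
      apply (coercive_small _ _ _ _ _ _ _ _ _ _ _ _ G D HG); [intros; apply HgG|].
      rewrite extend_id by lra. apply H. lra. }
  destruct HC0 as (C0 & HC0 & HW).
  assert (Hsmax0 : 0 <= smax) by (specialize (Hsmax 0); specialize (Hsb 0); lra).
  destruct (dirichlet_bounds alpha G C0 smax Hal HG HC0 Hsmax0) as (C & HC & HCb).
  set (K := 3 * (C * (Re kap ^ 2 + Im kap ^ 2) * (1 + / (s1min * smin))) + (1 + 2 * Rabs (Re mu))).
  assert (HK : 0 <= K).
  { assert (H1 := sum_sqr_ge_0 (Re kap) (Im kap)). assert (H2 := Rabs_pos (Re mu)).
    assert (H3 : 0 < / (s1min * smin)) by (apply Rinv_0_lt_compat, Rmult_lt_0_compat; trivial).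
    assert (H4 : 0 <= C * (Re kap ^ 2 + Im kap ^ 2) * (1 + / (s1min * smin)))
      by (apply Rmult_le_pos; [now apply Rmult_le_pos | lra]).
    unfold K. lra. }
  (* Gronwall bounds squared norms, hence the root; [0 <= K] allows r to be replaced by rmax in the
     exponent. *)
  exists (sqrt (exp (K * rmax))).
  intros v0 v (V & HV & Heq & Hv0 & Hbd) r Hr.
  assert (PS := is_solution_pulled rmax alpha q _ s (S 1%nat) beta B V v Hrm Hs Hc Hc1 Hd Hq HB HV Heq Hbd).
  cbv zeta in PS. fold mu in PS. fold kap in PS. fold g1 in PS. fold g2 in PS.
  set (X i j := pull rmax s (fun r z => Re (V i j r z))) in PS.
  set (Y i j := pull rmax s (fun r z => Im (V i j r z))) in PS.
  assert (HN : forall f t, 0 <= t <= rmax -> (forall z, 0 <= z <= s t -> v t z = f z) ->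
    hnorm (s t) l f = sqrt (sum_f_R0 (fun j => energy (extend rmax s) X Y j t) l)).
  { intros f t Ht Hf. rewrite <- (extend_id rmax s t Ht).
    apply (hnorm_energy rmax (extend rmax s) (extend rmax (S 1%nat))); trivial.
    - apply (ps_X _ _ _ _ _ _ _ _ _ _ _ _ PS).
    - apply (ps_Y _ _ _ _ _ _ _ _ _ _ _ _ PS).
    - rewrite extend_id by trivial. now apply Hs.
    - rewrite extend_id by trivial. intros z Hz. unfold X, Y, pull.
      rewrite (clamp_id 0 rmax t Ht), (extend_id rmax s t Ht).
      assert (Hz1 : 0 <= z / s t <= 1).
      { split; [apply Rlt_le, Rdiv_lt_0_compat; lra|].
        apply Rmult_le_reg_r with (s t); [lra|]. unfold Rdiv. rewrite Rmult_assoc, Rinv_l; lra. }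
      rewrite (clamp_id _ _ _ Hz1).
      replace (s t * (z / s t)) with z by (field; lra).
      rewrite (jet2_0 _ _ _ HV) by (split; lra). rewrite <- Hf by lra.
      now destruct (v t z). }
  rewrite (HN (v r) r Hr) by trivial.
  rewrite (HN v0 0) by (trivial; lra).
  rewrite <- sqrt_mult_alt by apply Rlt_le, exp_pos.
  apply sqrt_le_1_alt.
  assert (CX := pj_cont _ _ _ _ (ps_X _ _ _ _ _ _ _ _ _ _ _ _ PS)).
  assert (CY := pj_cont _ _ _ _ (ps_Y _ _ _ _ _ _ _ _ _ _ _ _ PS)).
  eapply Rle_trans; [apply (energy_stable rmax (extend rmax s) (extend rmax (S 1%nat)) alpha
    (Re mu) (Im mu) (Re kap) (Im kap) C smin s1min X Y g1 g2 l); trivial|].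
  - intros t Ht. cbv zeta.
    assert (D := pulled_dirichlet _ _ _ _ _ _ _ _ _ _ _ _ t PS Hal
      ltac:(specialize (Hsb t); lra) ltac:(intros u; specialize (Hs1b u); lra) Cg1 Cg2 Ht).
    destruct (HCb _ _ _ _ _ _ _ _ _ _ _ D (Hsmax t) (fun y _ => HgG t y) (HW t _ _ _ _ _ _ _ _ Ht D))
      as (H0 & H1 & H2 & H3).
    split; trivial. intros [|[|[|j]]] Hj; trivial. lia.
  - fold K. apply Rmult_le_compat_r.
    + apply cond_pos_sum. intros j. apply Rmult_le_pos; [specialize (Hsb 0); lra|].
      apply sqint_pos; cont.
    + destruct (proj2 Hr) as [H|H]; [|rewrite H; apply Rle_refl].
      destruct HK as [HK|HK]; [|rewrite <- HK, !Rmult_0_l; apply Rle_refl].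
      apply Rlt_le, exp_increasing. now apply Rmult_lt_compat_l.
Qed.
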